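(* Let $M$ be a countable model of $\mathsf{ZFC}$. Then $M$ has a minimum $\mathsf{GBC}$-realization if and only if $M$ has a global well-order which is first-order definable over $M$ using set parameters.
   Context: Models of second-order set theory are pairs $(M,\mathcal X)$, where $M$ is a model of first-order set theory (the sets) and $\mathcal X\subseteq\mathcal P(M)$ (the classes), membership between sets and classes being actual membership. $\mathsf{GB}$ (Gödel–Bernays set theory) consists of $\mathsf{ZF}$ for the sets, Extensionality for classes, Class Replacement (the image of a set under a class function is a set), and the Elementary Comprehension schema (for every formula with no class quantifiers, possibly with set and class parameters, the class of all sets satisfying it exists). Global Choice asserts there is a class bijection between $V$ and $\mathrm{Ord}$; $\mathsf{GBC}=\mathsf{GB}+$Global Choice. For a model $M$ of set theory, $\mathcal X\subseteq\mathcal P(M)$ is a $\mathsf{GBC}$-realization for $M$ if $(M,\mathcal X)\models\mathsf{GBC}$; it is the minimum $\mathsf{GBC}$-realization if it is contained in every $\mathsf{GBC}$-realization for $M$. *)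

(* Defs.v *)
From mathcomp Require Import all_boot.
From mathcomp Require Import boolp classical_sets cardinality.

Set Implicit Arguments.
Unset Strict Implicit.
Unset Printing Implicit Defensive.

Local Open Scope classical_set_scope.

(* Formulas of the language of second-order set theory without class
   quantifiers, with [k] free class variables and de Bruijn set variables.
   [formula 0] is the first-order language of set theory. Equality of classes
   is not primitive: it is expressible by Extensionality for classes. *)
Inductive formula (k : nat) : Type :=
| FMem (i j : nat)
| FEq (i j : nat)
| FCls (i : nat) (c : 'I_k)
| FFalse
| FImp (f g : formula k)
| FAll (f : formula k).

Definition scons (M : Type) (x : M) (v : nat -> M) : nat -> M :=
  fun n => if n is m.+1 then v m else x.

(* [v] supplies the set parameters; a formula only reads finitely many of its
   values. [W] supplies the class parameters. *)
Fixpoint sat (M : Type) (E : M -> M -> Prop) (k : nat) (W : 'I_k -> set M)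
    (v : nat -> M) (f : formula k) : Prop :=
  match f with
  | FMem i j => E (v i) (v j)
  | FEq i j => v i = v j
  | FCls i c => W c (v i)
  | FFalse => False
  | FImp g h => sat E W v g -> sat E W v h
  | FAll g => forall x, sat E W (scons x v) g
  end.

Definition fo_sat (M : Type) (E : M -> M -> Prop) (v : nat -> M)
    (f : formula 0) : Prop :=
  sat E (fun _ : 'I_0 => set0) v f.

Section SetTheory.
Variables (M : Type) (E : M -> M -> Prop).

Definition nonempty_in (a : M) : Prop := exists x, E x a.

Definition subset_in (a b : M) : Prop := forall x, E x a -> E x b.

Record ZF : Prop := {
  zf_extensionality : forall a b, (forall x, E x a <-> E x b) -> a = b;
  zf_foundation : forall a, nonempty_in a ->
    exists2 x, E x a & forall y, ~ (E y x /\ E y a);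
  zf_pairing : forall a b, exists c, forall x, E x c <-> x = a \/ x = b;
  zf_union : forall a, exists b, forall x, E x b <-> exists2 y, E y a & E x y;
  zf_powerset : forall a, exists b, forall x, E x b <-> subset_in x a;
  zf_infinity : exists w,
    (exists2 e, E e w & ~ nonempty_in e) /\
    (forall x, E x w ->
       exists2 s, E s w & forall z, E z s <-> E z x \/ z = x);
  zf_separation : forall (f : formula 0) (v : nat -> M) (a : M),
    exists b, forall x, E x b <-> E x a /\ fo_sat E (scons x v) f;
  zf_replacement : forall (f : formula 0) (v : nat -> M) (a : M),
    (forall x y y', E x a ->
       fo_sat E (scons x (scons y v)) f ->
       fo_sat E (scons x (scons y' v)) f -> y = y') ->
    exists b, forall y,
      E y b <-> exists2 x, E x a & fo_sat E (scons x (scons y v)) f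
}.

Definition choice_axiom : Prop := forall a,
  (forall x, E x a -> nonempty_in x) ->
  (forall x y z, E x a -> E y a -> E z x -> E z y -> x = y) ->
  exists c, forall x, E x a -> exists! z, E z x /\ E z c.

Definition ZFC : Prop := ZF /\ choice_axiom.

(* Kuratowski pairs: [p = {{x}, {x, y}}]. *)
Definition is_upair (c a b : M) : Prop := forall z, E z c <-> z = a \/ z = b.

Definition is_pair (p x y : M) : Prop :=
  exists s t, [/\ is_upair s x x, is_upair t x y & is_upair p s t].

(* Transitive and strictly well-ordered by membership. *)
Definition is_ordinal (a : M) : Prop :=
  [/\ forall x, E x a -> subset_in x a,
      forall x, E x a -> ~ E x x,
      forall x y z, E x a -> E y a -> E z a -> E x y -> E y z -> E x z,
      forall x y, E x a -> E y a -> E x y \/ x = y \/ E y x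
    & forall b, subset_in b a -> nonempty_in b ->
        exists2 m, E m b & forall x, E x b -> m = x \/ E m x].

Definition maps (F : set M) (x y : M) : Prop := exists2 p, is_pair p x y & F p.

Definition class_function (F : set M) : Prop :=
  (forall p, F p -> exists x y, is_pair p x y) /\
  (forall x y y', maps F x y -> maps F x y' -> y = y').

Definition bijection_V_Ord (F : set M) : Prop :=
  [/\ class_function F,
      forall x, exists y, maps F x y,
      forall x y, maps F x y -> is_ordinal y,
      forall x x' y, maps F x y -> maps F x' y -> x = x'
    & forall y, is_ordinal y -> exists x, maps F x y].

Record GB (X : set (set M)) : Prop := {
  gb_ZF : ZF;
  gb_class_extensionality : forall A B, X A -> X B ->
    (forall x, A x <-> B x) -> A = B;
  gb_class_replacement : forall F, X F -> class_function F ->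
    forall a, exists b, forall y, E y b <-> exists2 x, E x a & maps F x y;
  gb_elementary_comprehension :
    forall (k : nat) (f : formula k) (W : 'I_k -> set M) (v : nat -> M),
    (forall i, X (W i)) -> X [set x | sat E W (scons x v) f]
}.

Definition global_choice (X : set (set M)) : Prop :=
  exists2 F, X F & bijection_V_Ord F.

Definition GBC_realization (X : set (set M)) : Prop :=
  GB X /\ global_choice X.

Definition minimum_GBC_realization (X : set (set M)) : Prop :=
  GBC_realization X /\ forall Y, GBC_realization Y -> X `<=` Y.

Definition definable_class (A : set M) : Prop :=
  exists (f : formula 0) (v : nat -> M), A = [set x | fo_sat E (scons x v) f].

Definition definable_relation (R : M -> M -> Prop) : Prop :=
  exists (f : formula 0) (v : nat -> M),
    forall x y, R x y <-> fo_sat E (scons x (scons y v)) f.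

(* A strict well-order of the universe as seen by the model: [M] may be
   ill-founded, so least elements are required of the nonempty classes of the
   model, which for a definable order are the definable ones (in particular,
   of every nonempty set of the model). *)
Definition global_well_order (R : M -> M -> Prop) : Prop :=
  [/\ forall x, ~ R x x,
      forall x y z, R x y -> R y z -> R x z,
      forall x y, R x y \/ x = y \/ R y x
    & forall A, definable_class A -> (exists x, A x) ->
        exists2 m, A m & forall x, A x -> m = x \/ R m x].

End SetTheory.

(* Main.v *)
(* If M has a definable global well-order, then the definable classes form a
   GBC-realization, and they belong to every GBC-realization by Elementary
   Comprehension.

   Conversely, let X be the minimum GBC-realization, with a bijection F from V
   to Ord in X. Force over M with the set-sized partial injections from V to
   Ord. This forcing is closed under unions of chains, so it adds no sets: the
   classes definable from a generic class G form a GBC-realization. If F were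
   not definable over M, then F could differ from every class definable from G:
   when no extension of p forces phi(x, G) to disagree with F at some x, then
   F = {x | some extension of p forces phi(x, G)} is definable, because the
   forcing relation is. Since M is countable, one chain of conditions
   handles all formulas and parameters, so that F is not definable from G,
   against the minimality of X. Hence F is definable over M, and it yields a
   definable global well-order. *)

Require Import Defs.
From mathcomp Require Import all_boot.
From mathcomp Require Import boolp classical_sets cardinality.

Set Implicit Arguments.
Unset Strict Implicit.
Unset Printing Implicit Defensive.

Local Open Scope classical_set_scope.

(** * Definability with parameters *)

Definition up (r : nat -> nat) (n : nat) : nat :=
  if n is m.+1 then (r m).+1 else 0.

Fixpoint ren (k : nat) (r : nat -> nat) (f : formula k) : formula k :=
  match f with
  | FMem i j => FMem k (r i) (r j)
  | FEq i j => FEq k (r i) (r j)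
  | FCls i c => FCls (r i) c
  | FFalse => FFalse k
  | FImp g h => FImp (ren r g) (ren r h)
  | FAll g => FAll (ren (up r) g)
  end.

(* Even variables are free, odd ones hold the parameters. *)
Definition merge (M : Type) (e w : nat -> M) (n : nat) : M :=
  if odd n then w n./2 else e n./2.

Section Definability.
Variables (M : Type) (E : M -> M -> Prop) (k : nat) (W : 'I_k -> set M).

Lemma sat_ren (f : formula k) (r : nat -> nat) (v : nat -> M) :
  sat E W v (ren r f) <-> sat E W (v \o r) f.
Proof.
elim: f r v => //= [g IHg h IHh r v|g IHg r v].
  by split=> H /IHg /H /IHh.
have e x : scons x (v \o r) = scons x v \o up r by apply/funext; case.
by split=> H x; have := H x; rewrite e IHg.
Qed.

Lemma merge_even (e w : nat -> M) n : merge e w n.*2 = e n.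
Proof. by rewrite /merge odd_double doubleK. Qed.

Lemma merge_odd (e w : nat -> M) n : merge e w n.*2.+1 = w n.
Proof. by rewrite /merge /= odd_double uphalf_double. Qed.

Lemma even_or_odd n : (exists m, n = m.*2) \/ (exists m, n = m.*2.+1).
Proof.
rewrite -(odd_double_half n); case: (odd n); first by right; exists n./2.
by left; exists n./2.
Qed.

(** Predicates on whole valuations let the closure rules be stated without naming free variables.
    The parameters sit in a valuation of their own, so that formulas combine without clashes. *)
Definition dfn (Q : (nat -> M) -> Prop) : Prop :=
  exists (f : formula k) (w : nat -> M),
    forall e, Q e <-> sat E W (merge e w) f.

(** A term is definable when its graph is; this makes operations such as pairing usable inside
    definable predicates although the language has no function symbols. *)
Definition tdf (t : (nat -> M) -> M) : Prop :=
  dfn (fun e => e 0 = t (fun n => e n.+1)).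

Definition dfn1 (P : M -> Prop) : Prop := dfn (fun e => P (e 0)).
Definition dfn2 (P : M -> M -> Prop) : Prop := dfn (fun e => P (e 0) (e 1)).
Definition dfn3 (P : M -> M -> M -> Prop) : Prop :=
  dfn (fun e => P (e 0) (e 1) (e 2)).

Lemma dfn_ext (Q Q' : (nat -> M) -> Prop) :
  (forall e, Q e <-> Q' e) -> dfn Q -> dfn Q'.
Proof. by move=> H [f [w Hf]]; exists f, w => e; rewrite -H. Qed.

Lemma dfn_subst (Q : (nat -> M) -> Prop) (t : nat -> (nat -> M) -> M) :
  (forall n, (exists i, forall e, t n e = e i) \/
             (exists c, forall e, t n e = c)) ->
  dfn Q -> dfn (fun e => Q (fun n => t n e)).
Proof.
move=> Ht [f [w Hf]].
have [r Hr] : exists r : nat -> nat + M, forall n e,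
    t n e = match r n with inl i => e i | inr c => c end.
  have /choice[r Hr] : forall n, exists r : nat + M, forall e,
      t n e = match r with inl i => e i | inr c => c end.
    by move=> n; case: (Ht n) => -[i Hi]; [exists (inl i)|exists (inr i)].
  by exists r.
(* The constants join the old parameters in [merge w c], and [s] redirects each variable to the
   variable or constant replacing it; [w 0] is a filler. *)
pose c n := if r n is inr c then c else w 0.
pose s n := if odd n then (n./2).*2.*2.+1 else
  if r n./2 is inl i then i.*2 else (n./2).*2.+1.*2.+1.
exists (ren s f), (merge w c) => e; rewrite Hf sat_ren.
suff -> : merge (fun n => t n e) w = merge e (merge w c) \o s by [].
apply/funext => n; rewrite /= /s; case: (even_or_odd n) => -[m ->].
  rewrite merge_even odd_double doubleK Hr.
  case Er: (r m) => [i|d]; first by rewrite merge_even.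
  by rewrite !merge_odd /c Er.
by rewrite merge_odd /= odd_double /= uphalf_double merge_odd merge_even.
Qed.

Lemma dfn_imp Q Q' : dfn Q -> dfn Q' -> dfn (fun e => Q e -> Q' e).
Proof.
move=> [f [w Hf]] [g [u Hg]].
(* The parameters of both formulas are interleaved in [merge w u]; [s] moves those of the first to
   its even places and those of the second to its odd places. *)
pose s (b : bool) n := if odd n then ((n./2).*2 + b).*2.+1 else n.
exists (FImp (ren (s false) f) (ren (s true) g)), (merge w u) => e /=.
rewrite !sat_ren Hf Hg.
suff [-> ->] : merge e w = merge e (merge w u) \o s false /\
  merge e u = merge e (merge w u) \o s true by [].
by split; apply/funext => n; rewrite /= /s; case: (even_or_odd n) => -[m ->];
   rewrite /= ?odd_double /= ?merge_odd ?merge_even //= ?uphalf_double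
     ?addn0 ?addn1 ?merge_odd ?merge_even.
Qed.

Lemma dfn_all (Q : M -> (nat -> M) -> Prop) :
  dfn (fun e => Q (e 0) (fun n => e n.+1)) -> dfn (fun e => forall x, Q x e).
Proof.
move=> [f [w Hf]].
(* The bound element takes one place in front of [merge e w], but as a new free variable it moves
   the even places of the merge by two; [s] reconciles the layouts. *)
pose s n := if odd n then n.+1 else if n is m.+2 then m.+1 else 0.
exists (FAll (ren s f)), w => e /=.
suff H x : sat E W (scons x (merge e w)) (ren s f) <-> Q x e.
  by split=> H' x; apply/H.
rewrite sat_ren (_ : _ \o s = merge (scons x e) w) -?Hf //.
apply/funext => n; rewrite /= /s; case: (even_or_odd n) => -[m ->].
  by rewrite merge_even odd_double; case: m => //= m; rewrite merge_even.
by rewrite merge_odd /= odd_double /= merge_odd.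
Qed.

Lemma dfn_ren (s : nat -> nat) Q :
  dfn Q -> dfn (fun e => Q (fun n => e (s n))).
Proof. by apply: dfn_subst => n; left; exists (s n). Qed.

Lemma dfn_False : M -> dfn (fun=> False).
Proof. by move=> d; exists (FFalse k), (fun=> d). Qed.

Lemma dfn_not Q : dfn Q -> dfn (fun e => ~ Q e).
(* A witness of definability carries a parameter valuation, hence an element of [M]. *)
Proof. by move=> HQ; have [_ [w _]] := HQ; apply: dfn_imp (dfn_False (w 0)). Qed.

Lemma dfn_and Q Q' : dfn Q -> dfn Q' -> dfn (fun e => Q e /\ Q' e).
Proof.
move=> HQ HQ'; apply: dfn_ext (dfn_not (dfn_imp HQ (dfn_not HQ'))) => e.
by split=> [/not_implyP[? /contrapT]|[? ?]]; [|exact].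
Qed.

Lemma dfn_and3 P Q R : dfn P -> dfn Q -> dfn R ->
  dfn (fun e => [/\ P e, Q e & R e]).
Proof.
move=> HP HQ HR; apply: dfn_ext (dfn_and HP (dfn_and HQ HR)) => e.
by split=> [[? []]|[]].
Qed.

Lemma dfn_and4 P Q R S : dfn P -> dfn Q -> dfn R -> dfn S ->
  dfn (fun e => [/\ P e, Q e, R e & S e]).
Proof.
move=> HP HQ HR HS; apply: dfn_ext (dfn_and (dfn_and3 HP HQ HR) HS) => e.
by split=> [[[? ? ?]]|[]].
Qed.

Lemma dfn_and5 P Q R S T : dfn P -> dfn Q -> dfn R -> dfn S -> dfn T ->
  dfn (fun e => [/\ P e, Q e, R e, S e & T e]).
Proof.
move=> HP HQ HR HS HT.
apply: dfn_ext (dfn_and (dfn_and3 HP HQ HR) (dfn_and HS HT)) => e.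
by split=> [[[? ? ?] []]|[]].
Qed.

Lemma dfn_or Q Q' : dfn Q -> dfn Q' -> dfn (fun e => Q e \/ Q' e).
Proof.
move=> HQ HQ'; apply: dfn_ext (dfn_imp (dfn_not HQ) HQ') => e.
by split=> [H|[?|?] ?//]; case: (pselect (Q e)) => [|/H]; [left|right].
Qed.

Lemma dfn_iff Q Q' : dfn Q -> dfn Q' -> dfn (fun e => Q e <-> Q' e).
Proof. by move=> HQ HQ'; apply: dfn_and; apply: dfn_imp. Qed.

Lemma dfn_ex (Q : M -> (nat -> M) -> Prop) :
  dfn (fun e => Q (e 0) (fun n => e n.+1)) -> dfn (fun e => exists x, Q x e).
Proof.
move=> /dfn_not/(@dfn_all (fun x e => ~ Q x e))/dfn_not; apply: dfn_ext => e.
by split=> [/existsNP[x /contrapT]|[x Qx] /(_ x)]; [exists x|].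
Qed.

Lemma dfn_ex2 (P Q : M -> (nat -> M) -> Prop) :
  dfn (fun e => P (e 0) (fun n => e n.+1)) ->
  dfn (fun e => Q (e 0) (fun n => e n.+1)) ->
  dfn (fun e => exists2 x, P x e & Q x e).
Proof.
move=> HP HQ; apply: (@dfn_ext (fun e => exists x, P x e /\ Q x e)).
  by move=> e; split=> [[x []]|[x]]; exists x.
by apply: dfn_ex; apply: dfn_and.
Qed.

Lemma tdf_var i : M -> tdf (fun e => e i).
Proof.
move=> d; exists (FEq k 0 i.+1.*2), (fun=> d) => e /=.
by rewrite (merge_even _ _ i.+1).
Qed.

Lemma tdf_const c : tdf (fun=> c).
Proof. by exists (FEq k 0 1), (fun=> c). Qed.

(** The term is eliminated through its graph, by an existential quantifier over its value. *)
Lemma dfn_let (t : (nat -> M) -> M) (Q : M -> (nat -> M) -> Prop) :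
  tdf t -> dfn (fun e => Q (e 0) (fun n => e n.+1)) -> dfn (fun e => Q (t e) e).
Proof.
move=> Ht HQ; apply: (@dfn_ext (fun e => exists x, x = t e /\ Q x e)).
  by move=> e; split=> [[x [->]]|]; last exists (t e).
by apply: dfn_ex; apply: dfn_and.
Qed.

Lemma tdf_shift t : tdf t -> tdf (fun e => t (fun n => e n.+1)).
Proof.
exact: (@dfn_ren (fun n => if n is m.+1 then m.+2 else 0)).
Qed.

Lemma dfn_app1 P t : dfn1 P -> tdf t -> dfn (fun e => P (t e)).
Proof. by move=> HP Ht; apply: (@dfn_let t (fun x _ => P x)). Qed.

Lemma dfn_app2 P t u : dfn2 P -> tdf t -> tdf u -> dfn (fun e => P (t e) (u e)).
Proof.
move=> HP Ht Hu; apply: (@dfn_let t (fun x e => P x (u e))) => //.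
apply: (@dfn_let (fun e => u (fun n => e n.+1)) (fun x e => P (e 0) x)).
  exact: tdf_shift.
exact: (@dfn_ren (fun n => if n is 0 then 1 else 0) (fun e => P (e 0) (e 1))).
Qed.

Lemma dfn_app3 P t u v : dfn3 P -> tdf t -> tdf u -> tdf v ->
  dfn (fun e => P (t e) (u e) (v e)).
Proof.
move=> HP Ht Hu Hv; apply: (@dfn_let t (fun x e => P x (u e) (v e))) => //.
apply: (@dfn_let (fun e => u (fun n => e n.+1))
  (fun x e => P (e 0) x (v (fun n => e n.+1)))); first exact: tdf_shift.
apply: (@dfn_let (fun e => v (fun n => e n.+2)) (fun x e => P (e 1) (e 0) x)).
  exact: (tdf_shift (tdf_shift Hv)).
exact: (@dfn_ren (fun n => if n is m.+1 then if m is 0 then 1 else 0 else 2)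
  (fun e => P (e 0) (e 1) (e 2))).
Qed.

Lemma tdf_app2 g t u : dfn3 (fun y x x' => y = g x x') -> tdf t -> tdf u ->
  tdf (fun e => g (t e) (u e)).
Proof.
move=> Hg Ht Hu; have [_ [w _]] := Hg.
exact: (dfn_app3 Hg (tdf_var 0 (w 0)) (tdf_shift Ht) (tdf_shift Hu)).
Qed.

Lemma dfn_E t u : tdf t -> tdf u -> dfn (fun e => E (t e) (u e)).
Proof.
move=> Ht; have [_ [w _]] := Ht; apply: dfn_app2 Ht.
by exists (FMem k 0 2), w.
Qed.

Lemma dfn_eq t u : tdf t -> tdf u -> dfn (fun e => t e = u e).
Proof.
move=> Ht; have [_ [w _]] := Ht; apply: (dfn_app2 _ Ht).
by exists (FEq k 0 2), w.
Qed.

Lemma dfn_cls c t : tdf t -> dfn (fun e => W c (t e)).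
Proof.
move=> Ht; have [_ [w _]] := Ht; apply: (dfn_app1 _ Ht).
by exists (FCls 0 c), w.
Qed.

End Definability.

(* Extension point for the operations introduced later. *)
Ltac dfn_hook := fail.
(** One closure rule per step, following the syntax of the predicate; definability facts in the
    context act as rules for the predicates they concern. *)
Ltac dfn_step :=
  cbv beta;
  first
  [ assumption
  | dfn_hook
  | match goal with H : dfn1 _ _ _ |- _ => apply (dfn_app1 H) end
  | match goal with H : dfn2 _ _ _ |- _ => apply (dfn_app2 H) end
  | match goal with H : dfn3 _ _ _ |- _ => apply (dfn_app3 H) end
  | match goal with
    | |- dfn _ _ (fun e => _ /\ _) => apply dfn_and
    | |- dfn _ _ (fun e => and3 _ _ _) => apply dfn_and3
    | |- dfn _ _ (fun e => and4 _ _ _ _) => apply dfn_and4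
    | |- dfn _ _ (fun e => and5 _ _ _ _ _) => apply dfn_and5
    | |- dfn _ _ (fun e => _ \/ _) => apply dfn_or
    | |- dfn _ _ (fun e => ~ _) => apply dfn_not
    | |- dfn _ _ (fun e => _ <-> _) => apply dfn_iff
    | |- dfn _ _ (fun e => exists x, _) => apply dfn_ex
    | |- dfn _ _ (fun e => exists2 x, _ & _) => apply dfn_ex2
    | |- dfn _ _ (fun e => _ = _) => apply dfn_eq
    | |- dfn _ _ (fun e => False) => apply dfn_False; assumption
    | |- dfn1 _ _ _ => unfold dfn1
    | |- dfn2 _ _ _ => unfold dfn2
    | |- dfn3 _ _ _ => unfold dfn3
    | |- tdf _ _ (fun e => _) => first [apply tdf_const | apply tdf_var; assumption]
    end
  | apply dfn_E
  | apply dfn_cls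
  | apply dfn_imp
  | apply dfn_all ].
Ltac definability := repeat dfn_step.

(** * Classes definable from given classes *)

Section DefinableClasses.
Variables (M : Type) (E : M -> M -> Prop) (k : nat) (W : 'I_k -> set M).

Lemma dfn1P A : dfn1 E W A ->
  exists (f : formula k) (v : nat -> M),
    forall x, A x <-> sat E W (scons x v) f.
Proof.
move=> [f [w Hf]].
(* Here [w] serves both as the rest of the valuation and as the parameters, so odd places and even
   places past the first all read from it. *)
pose s n := if odd n then n./2.+1 else n./2.
exists (ren s f), w => x; rewrite sat_ren (Hf (scons x (fun n => w n))).
suff -> : merge (scons x [eta w]) w = scons x w \o s by [].
by apply/funext => n; rewrite /merge /= /s; case: (odd n).
Qed.

Lemma dfn2P A : dfn2 E W A ->
  exists (f : formula k) (v : nat -> M),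
    forall x y, A x y <-> sat E W (scons x (scons y v)) f.
Proof.
move=> [f [w Hf]].
pose s n := if odd n then n./2.+2 else n./2.
exists (ren s f), w => x y.
rewrite sat_ren (Hf (scons x (scons y (fun n => w n)))).
suff -> : merge (scons x (scons y [eta w])) w = scons x (scons y w) \o s by [].
by apply/funext => n; rewrite /merge /= /s; case: (odd n).
Qed.

(** Definitions of the classes [W'] replace the class variables of [f]; this is what yields
    Elementary Comprehension for the classes definable from [W]. *)
Lemma dfn_sat k' (W' : 'I_k' -> set M) (f : formula k') : M ->
  (forall i, dfn1 E W (W' i)) -> dfn E W (fun e => sat E W' e f).
Proof.
move=> d HW; elim: f => [i j|i j|i c||g IHg h IHh|g IHg] /=;
  try by definability.
- by apply: (dfn_app1 (HW c)); definability.
- apply: dfn_all; apply: dfn_ext IHg => e.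
  by rewrite (_ : scons (e 0) (fun n => e n.+1) = e) //; apply/funext; case.
Qed.

(** Comprehension follows from [dfn_sat], so Class Replacement is the one axiom left to the
    particular choice of [W]. *)
Lemma GB_dfn1 : ZF E ->
  (forall F, dfn1 E W F -> class_function E F ->
    forall a, exists b, forall y, E y b <-> exists2 x, E x a & maps E F x y) ->
  GB E [set A | dfn1 E W A].
Proof.
move=> hZF hrep; split=> //.
- by move=> A B _ _ AB; apply/funext => x; apply/propext.
- move=> j f W' v HW.
  have := @dfn_subst _ _ _ _ _ (fun n e => scons (e 0) v n) _ (dfn_sat f (v 0) HW).
  by apply; case=> [|n] /=; [left; exists 0|right; exists (v n)].
Qed.

End DefinableClasses.

Lemma definable_classP M (E : M -> M -> Prop) (A : set M) :
  definable_class E A <-> dfn1 E (fun _ : 'I_0 => set0) A.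
Proof.
split=> [[f [v ->]]|/dfn1P[f [v Hf]]]; last first.
  by exists f, v; apply/funext => x; apply/propext; rewrite /= Hf.
have HW (i : 'I_0) : dfn1 E (fun _ : 'I_0 => set0) (@set0 M) by case: i.
apply: (@dfn_subst _ _ _ _ _ (fun n e => scons (e 0) v n) _
  (dfn_sat f (v 0) HW)).
by case=> [|n] /=; [left; exists 0|right; exists (v n)].
Qed.

Lemma definable_relationP M (E : M -> M -> Prop) (R : M -> M -> Prop) :
  definable_relation E R <-> dfn2 E (fun _ : 'I_0 => set0) R.
Proof.
split=> [[f [v Hf]]|/dfn2P//].
have HW (i : 'I_0) : dfn1 E (fun _ : 'I_0 => set0) (@set0 M) by case: i.
pose t n (e : nat -> M) := scons (e 0) (scons (e 1) v) n.
apply: dfn_ext (dfn_subst (t := t) _ (dfn_sat f (v 0) HW)) => [e|].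
  by rewrite Hf.
case=> [|[|n]] /=; [by left; exists 0|by left; exists 1|by right; exists (v n)].
Qed.

(** * Set theory inside the model *)

Section SetTheory.
Variables (M : Type) (E : M -> M -> Prop).
Hypothesis hZF : ZF E.

Local Notation def := (@dfn M E 0 (fun=> set0)).
Local Notation term := (@tdf M E 0 (fun=> set0)).
Local Notation def1 := (@dfn1 M E 0 (fun=> set0)).
Local Notation def2 := (@dfn2 M E 0 (fun=> set0)).
Local Notation def3 := (@dfn3 M E 0 (fun=> set0)).
Local Notation sub := (subset_in E).

Lemma ext_in a b : (forall x, E x a <-> E x b) -> a = b.
Proof. exact: zf_extensionality. Qed.

Lemma sep_ex P : def1 P -> forall a, exists b, forall x, E x b <-> E x a /\ P x.
Proof.
move=> /dfn1P[f [v Hf]] a; have [b Hb] := zf_separation hZF f v a.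
by exists b => x; rewrite Hb Hf.
Qed.

Lemma repl_ex P : def2 P -> forall a,
  (forall x y y', E x a -> P x y -> P x y' -> y = y') ->
  exists b, forall y, E y b <-> exists2 x, E x a & P x y.
Proof.
move=> /dfn2P[f [v Hf]] a Ha.
have [|b Hb] := zf_replacement hZF (f := f) (v := v) (a := a).
  by move=> x y y' xa; rewrite /fo_sat -!Hf; exact: Ha.
by exists b => y; rewrite Hb; split=> -[x xa H]; exists x => //; apply/Hf.
Qed.

Definition upr a b : M := sval (cid (zf_pairing hZF a b)).
Definition Union a : M := sval (cid (zf_union hZF a)).
Definition Pow a : M := sval (cid (zf_powerset hZF a)).
Definition opair x y : M := upr (upr x x) (upr x y).
(** This is a ∪ {b}; with [b] equal to [a] it is the ordinal successor. *)
Definition adj a b : M := Union (upr a (upr b b)).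

Lemma uprP a b x : E x (upr a b) <-> x = a \/ x = b.
Proof. exact: (svalP (cid (zf_pairing hZF a b))). Qed.

Lemma UnionP a x : E x (Union a) <-> exists2 y, E y a & E x y.
Proof. exact: (svalP (cid (zf_union hZF a))). Qed.

Lemma PowP a x : E x (Pow a) <-> sub x a.
Proof. exact: (svalP (cid (zf_powerset hZF a))). Qed.

Lemma adjP a b x : E x (adj a b) <-> E x a \/ x = b.
Proof.
rewrite /adj UnionP; split=> [[y /uprP[->|->]]|[xa|->]]; first by left.
- by move=> /uprP[->|->]; right.
- by exists a => //; apply/uprP; left.
- by exists (upr b b); apply/uprP; [right|left].
Qed.

Lemma is_pairP p x y : is_pair E p x y <-> p = opair x y.
Proof.
split=> [[s [t [Hs Ht Hp]]]|->].
  have -> : p = upr s t by apply: ext_in => z; rewrite uprP Hp.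
  by congr upr; apply: ext_in => z; rewrite uprP ?Hs ?Ht.
by exists (upr x x), (upr x y); split=> z; rewrite uprP.
Qed.

Lemma upr_inj a b c : upr a b = upr a c -> b = c.
Proof.
move=> H; have /uprP[|//] : E b (upr a c) by rewrite -H; apply/uprP; right.
have /uprP[|-> //] : E c (upr a b) by rewrite H; apply/uprP; right.
by move=> -> ->.
Qed.

Lemma opair_inj x y x' y' : opair x y = opair x' y' -> x = x' /\ y = y'.
Proof.
move=> H; suff xx' : x = x'.
  by rewrite -xx' /opair in H; move/upr_inj/upr_inj: H.
have /uprP[] : E (upr x x) (opair x' y') by rewrite -H; apply/uprP; left.
  by move=> H1; have : E x (upr x x) by [apply/uprP; left];
     rewrite H1 => /uprP[].
move=> H1; have : E x' (upr x x) by rewrite H1; apply/uprP; left.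
by move=> /uprP[].
Qed.

Lemma term_opair t u : term t -> term u -> term (fun e => opair (t e) (u e)).
Proof.
move=> Ht; have [_ [w _]] := Ht; apply: tdf_app2 Ht.
apply: (@dfn_ext _ _ _ _ (fun e => is_pair E (e 0) (e 1) (e 2))).
  by move=> e; rewrite is_pairP.
by have d := w 0; cbv delta [is_pair is_upair]; definability.
Qed.

Lemma no_cycle1 x : ~ E x x.
Proof.
move=> H; have [|y] := zf_foundation hZF (a := upr x x).
  by exists x; apply/uprP; left.
by move=> /uprP yx /(_ x) []; split; [case: yx => ->|apply/uprP; left].
Qed.

Lemma no_cycle3 x y z : ~ [/\ E x y, E y z & E z x].
Proof.
move=> [xy yz zx]; have [|t] := zf_foundation hZF (a := adj (upr x y) z).
  by exists z; apply/adjP; right.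
move=> /adjP[/uprP[->|->]|->].
- by move=> /(_ z)[]; split=> //; apply/adjP; right.
- by move=> /(_ x)[]; split=> //; apply/adjP; left; apply/uprP; left.
- by move=> /(_ y)[]; split=> //; apply/adjP; left; apply/uprP; right.
Qed.

Lemma no_cycle2 x y : ~ (E x y /\ E y x).
Proof.
move=> [xy yx]; have [|t] := zf_foundation hZF (a := upr x y).
  by exists x; apply/uprP; left.
move=> /uprP[->|->]; first by move=> /(_ y)[]; split=> //; apply/uprP; right.
by move=> /(_ x)[]; split=> //; apply/uprP; left.
Qed.

Lemma no_universe a : exists x, ~ E x a.
Proof. by exists a; exact: no_cycle1. Qed.

(** * Ordinals of the model *)

Definition transitive_in a := forall x, E x a -> sub x a.

(** By Foundation, a transitive set on which membership is total is a von Neumann ordinal. *)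
Definition ord a := transitive_in a /\
  forall x y, E x a -> E y a -> E x y \/ x = y \/ E y x.

Lemma is_ordinalP a : is_ordinal E a <-> ord a.
Proof.
split=> [[]//|[tra tri]]; split=> //.
- by move=> x _; exact: no_cycle1.
- move=> x y z xa ya za xy yz; case: (tri x z) => // -[xz|zx].
    by case: (@no_cycle2 x y); rewrite {2}xz.
  by case: (@no_cycle3 x y z).
- move=> b ba /(zf_foundation hZF)[m mb Hm]; exists m => // x xb.
  case: (tri m x (ba _ mb) (ba _ xb)) => [|[]]; [by right|by left|].
  by move=> xm; case: (Hm x).
Qed.

Lemma def_ord t : term t -> def (fun e => ord (t e)).
Proof.
move=> Ht; have [_ [w _]] := Ht; apply: dfn_app1 Ht; have d := w 0.
by cbv delta [ord transitive_in subset_in]; definability.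
Qed.

Ltac dfn_hook ::= first [apply def_ord | apply term_opair].

Lemma ord_in a x : ord a -> E x a -> ord x.
Proof.
move=> [tra tri] xa; split=> [y yx z zy|y z yx zx]; last first.
  by apply: tri; exact: (tra x).
have za : E z a by apply: (tra y) => //; exact: (tra x).
case: (tri z x) => // -[zx|xz].
  by case: (@no_cycle2 y z); split=> //; rewrite zx.
by case: (@no_cycle3 z y x).
Qed.

Lemma ord_trans a x y : ord a -> E x a -> E y x -> E y a.
Proof. by move=> [tra _] xa; exact: tra. Qed.

Lemma ord_sub a b : ord a -> ord b -> sub a b -> a = b \/ E a b.
Proof.
move=> oa ob ab; case: (pselect (sub b a)) => [ba|].
  by left; apply: ext_in => x; split=> [/ab|/ba].
move=> /existsNP[y /not_implyP[yb ya]]; right.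
have [|c Hc] := sep_ex (P := fun x => ~ E x a) _ b; first by definability.
have [|m /Hc[mb ma] Hm] := zf_foundation hZF (a := c).
  by exists y; apply/Hc.
(* The minimal element of b \ a is [a] itself. *)
suff -> : a = m by [].
apply: ext_in => x; split=> [xa|xm].
  case: (ob.2 x m (ab _ xa) mb) => // -[xm|mx]; first by case: ma; rewrite -xm.
  by case: ma; apply: ord_trans mx.
apply: contrapT => xa; case: (Hm x); split=> //; apply/Hc; split=> //.
exact: ord_trans xm.
Qed.

(** The intersection of [a] and [b] is an ordinal; were it a proper part of both, it would belong to
    both and hence to itself. *)
Lemma ord_tri a b : ord a -> ord b -> E a b \/ a = b \/ E b a.
Proof.
move=> oa ob.
have [|c Hc] := sep_ex (P := fun x => E x b) _ a; first by definability.
have oc : ord c.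
  split=> [x /Hc[xa xb] y yx|x y /Hc[xa xb] /Hc[ya yb]]; last exact: oa.2.
  by apply/Hc; split; [apply: ord_trans yx|apply: ord_trans yx].
have [|ca|ca] := ord_sub oc oa; first by move=> x /Hc[].
  have [|cb|cb] := ord_sub oc ob; first by move=> x /Hc[].
    by right; left; rewrite -ca.
  by left; rewrite -ca.
have [|cb|cb] := ord_sub oc ob; first by move=> x /Hc[].
  by rewrite -cb; right; right.
by case: (@no_cycle1 c); apply/Hc.
Qed.

Lemma ord_succ a : ord a -> ord (adj a a).
Proof.
move=> oa; split=> [x /adjP[xa|->] y yx|x y /adjP[xa|->] /adjP[ya|->]].
- by apply/adjP; left; apply: ord_trans yx.
- by apply/adjP; left.
- exact: oa.2.
- by left.
- by right; right.
- by right; left.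
Qed.

Lemma ord_Union S : (forall x, E x S -> ord x) -> ord (Union S).
Proof.
move=> HS; split=> [x /UnionP[y yS xy] z zx|x y].
  by apply/UnionP; exists y => //; apply: ord_trans xy zx; exact: HS.
move=> /UnionP[u uS xu] /UnionP[v vS yv].
by apply: ord_tri; [apply: ord_in xu|apply: ord_in yv]; exact: HS.
Qed.

Lemma ord_bound S : (forall x, E x S -> ord x) ->
  exists2 b, ord b & forall x, E x S -> E x b.
Proof.
move=> HS; exists (adj (Union S) (Union S)).
  by apply: ord_succ; exact: ord_Union.
move=> x xS; apply/adjP.
have [|||->|] := @ord_sub x (Union S).
- exact: HS.
- exact: ord_Union.
- by move=> y yx; apply/UnionP; exists x.
- by right.
- by left.
Qed.

(** Separation below the successor of [a] turns the class into a set, to which Foundation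
    applies. *)
Lemma ord_least P a : def1 P -> ord a -> P a ->
  exists b, [/\ ord b, P b & forall c, E c b -> ~ P c].
Proof.
move=> HP oa Pa; have [c Hc] := sep_ex HP (adj a a).
have [|m /Hc[mb Pm] Hm] := zf_foundation hZF (a := c).
  by exists a; apply/Hc; split=> //; apply/adjP; right.
exists m; split=> // [|x xm Px]; first by apply: ord_in mb; exact: ord_succ.
apply: (Hm x); split=> //; apply/Hc; split=> //.
by apply: ord_trans mb xm; exact: ord_succ.
Qed.

Lemma ord_ind P : def1 P ->
  (forall a, ord a -> (forall b, E b a -> P b) -> P a) ->
  forall a, ord a -> P a.
Proof.
move=> HP IH a oa; apply: contrapT => nPa.
have [|b [ob nPb Hb]] := @ord_least (fun x => ~ P x) a _ oa nPa.
  by definability.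
by apply: nPb; apply: IH => // c /Hb /contrapT.
Qed.

(** Burali-Forti: a bound for all ordinals of [a] would belong to itself if it were in [a]. *)
Lemma ord_unbounded a : exists2 b, ord b & ~ E b a.
Proof.
have [|S HS] := sep_ex (P := ord) _ a; first by have d := a; definability.
have [|b ob Hb] := @ord_bound S; first by move=> x /HS[].
by exists b => // ba; case: (@no_cycle1 b); apply: Hb; apply/HS.
Qed.

(** Replacement along the inverse of [F] would collect all ordinals into a set. *)
Lemma no_ord_injection F a : def2 F ->
  (forall b, ord b -> exists2 y, E y a & F b y) ->
  (forall b c y, ord b -> ord c -> F b y -> F c y -> b = c) -> False.
Proof.
move=> HF Htot Hinj.
have [||c Hc] := repl_ex (P := fun y b => F b y /\ ord b) _ (a := a).
- by have d := a; definability.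
- by move=> y b c _ [? ?] [? ?]; apply: Hinj; eauto.
have [b ob] := ord_unbounded c; apply; apply/Hc.
by have [y ya Fby] := Htot b ob; exists y.
Qed.

(** Taking the least ordinal for each [x] makes the relation functional, so Replacement applies;
    monotonicity then lifts all of them to a common bound. *)
Lemma ord_collection Phi a : def2 Phi ->
  (forall x, E x a -> exists2 c, ord c & Phi x c) ->
  (forall x c b, ord b -> E c b -> Phi x c -> Phi x b) ->
  exists2 c, ord c & forall x, E x a -> Phi x c.
Proof.
move=> HP Hex Hmono; have d := a.
have [||S HS] := repl_ex (P := fun x c =>
    [/\ ord c, Phi x c & forall b, E b c -> ~ Phi x b]) _ (a := a).
- by definability.
- move=> x c c' _ [oc Pc Hc] [oc' Pc' Hc'].
  by case: (ord_tri oc oc') => [/Hc'//|[//|/Hc]].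
have [|b ob Hb] := @ord_bound S; first by move=> x /HS[? _ []].
exists b => // x xa; have [c oc Pc] := Hex x xa.
have [|m [om Pm Hm]] := @ord_least (Phi x) c _ oc Pc; first by definability.
by apply: (Hmono _ m) => //; apply: Hb; apply/HS; exists x.
Qed.

(** It is the union of the ordinals in an inductive set, which are closed under successor. *)
Lemma limit_ordinal : exists2 l, ord l &
  (exists b, E b l) /\ forall b, E b l -> E (adj b b) l.
Proof.
have [w [[e ew ne] sw]] := zf_infinity hZF.
have [|S HS] := sep_ex (P := ord) _ w; first by definability.
have Sord x : E x S -> ord x by move=> /HS[].
have oe : ord e by split=> [x xe|x y xe]; case: ne; exists x.
have sS x : E x S -> E (adj x x) S.
  move=> /HS[xw ox]; apply/HS; split; last exact: ord_succ.
  have [s sw' Hs] := sw x xw; suff <- : s = adj x x by [].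
  by apply: ext_in => z; rewrite Hs adjP.
exists (Union S); first exact: ord_Union.
have inU x : E x S -> E x (Union S).
  by move=> xS; apply/UnionP; exists (adj x x); [exact: sS|apply/adjP; right].
split; first by exists e; apply: inU; apply/HS.
move=> b /UnionP[c cS bc]; have ob := ord_in (Sord _ cS) bc.
case: (ord_tri (ord_succ ob) (Sord _ cS)) => [|[|/adjP[|]]].
- by move=> H; apply/UnionP; exists c.
- by move=> ->; exact: inU.
- by move=> cb; case: (@no_cycle2 b c).
- by move=> cb; case: (@no_cycle1 b); rewrite -{2}cb.
Qed.

(** * Definable transfinite recursion, possibly partial *)

Section Recursion.
Variable H : M -> M -> M -> Prop.
Hypotheses (defH : def3 H)
  (funH : forall a r y y', H a r y -> H a r y' -> y = y').

Definition is_range r f b := forall u, E u r <-> exists2 c, E c b & E (opair c u) f.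

(** A set-sized partial solution with downward closed domain; [approx_unique] applied to [f] twice
    makes it a function. *)
Definition approx f := forall b y, E (opair b y) f ->
  [/\ ord b, forall c, E c b -> exists u, E (opair c u) f
    & exists r, is_range r f b /\ H b r y].

(* The class function [F] with [F a = H a {F b | b < a}], defined as long as
   [H] is. *)
Definition Rec b y := exists f, approx f /\ E (opair b y) f.

Lemma def_Rec : def2 Rec.
Proof.
have [_ [w _]] := defH; have d := w 0.
by cbv delta [Rec approx is_range]; definability.
Qed.

(** Induction on [b]: agreement below [b] gives both the same range of earlier values, and [funH]
    does the rest. *)
Lemma approx_unique f g b y y' : approx f -> approx g ->
  E (opair b y) f -> E (opair b y') g -> y = y'.
Proof.
move=> af ag Hy; have [ob _ _] := af _ _ Hy; move: b ob y y' Hy.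
apply: ord_ind => [|b ob IH y y' bf bg]; first by have d := f; definability.
have [_ totf [r [Hr Hy]]] := af _ _ bf; have [_ totg [s [Hs Hy']]] := ag _ _ bg.
suff rs : r = s by apply: (@funH b r); rewrite // rs.
apply: ext_in => u; rewrite Hr Hs; split=> -[c cb cu]; exists c => //.
  by have [v cv] := totg c cb; rewrite (IH c cb u v).
by have [v cv] := totf c cb; rewrite -(IH c cb v u).
Qed.

Lemma Rec_fun b y y' : Rec b y -> Rec b y' -> y = y'.
Proof. by move=> [f [af fy]] [g [ag gy]]; exact: approx_unique fy gy. Qed.

Lemma Rec_ord b y : Rec b y -> ord b.
Proof. by move=> [f [af /af[]]]. Qed.

Lemma Rec_range a : ord a ->
  exists r, forall u, E u r <-> exists2 b, E b a & Rec b u.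
Proof.
move=> oa; apply: repl_ex; first exact: def_Rec.
by move=> x y y' _; exact: Rec_fun.
Qed.

Lemma Rec_unfold a y r : (forall u, E u r <-> exists2 b, E b a & Rec b u) ->
  Rec a y -> H a r y.
Proof.
move=> Hr [f [af fy]]; have [_ tot [s [Hs Hy]]] := af _ _ fy.
suff -> : r = s by [].
apply: ext_in => u; rewrite Hs Hr; split=> -[c ca cu]; exists c => //.
  have [v cv] := tot c ca; suff -> : u = v by [].
  by apply: Rec_fun cu _; exists f.
by exists f.
Qed.

Lemma Rec_val b y : Rec b y ->
  exists r, (forall u, E u r <-> exists2 c, E c b & Rec c u) /\ H b r y.
Proof.
move=> Fb; have [r Hr] := Rec_range (Rec_ord Fb).
by exists r; split=> //; exact: Rec_unfold Fb.
Qed.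

Lemma Rec_fold a y r : ord a -> (forall b, E b a -> exists u, Rec b u) ->
  (forall u, E u r <-> exists2 b, E b a & Rec b u) -> H a r y -> Rec a y.
Proof.
move=> oa tot Hr Hy; have d := a; have dR := def_Rec.
(* Replacement collects the values below [a] into a set; adding the pair of [a] and [y] gives an
   approximation reaching [a]. *)
have [||f0 Hf0] := repl_ex
    (P := fun b z => exists u, Rec b u /\ z = opair b u) _ (a := a).
- by definability.
- by move=> b z z' _ [u [bu ->]] [v [bv ->]]; rewrite (Rec_fun bu bv).
pose f := adj f0 (opair a y).
have Hf b u : E (opair b u) f <-> (E b a /\ Rec b u) \/ (b = a /\ u = y).
  rewrite adjP Hf0; split=> [[|/opair_inj]|[[ba bu]|[-> ->]]].
  - by move=> [c ca [v [cv /opair_inj[-> ->]]]]; left.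
  - by right.
  - by left; exists b => //; exists u.
  - by right.
have Hf' c b u : sub b a -> E c b -> E (opair c u) f <-> Rec c u.
  move=> ba cb; rewrite Hf; split=> [[[]//|[ca _]]|cu]; last first.
    by left; split=> //; exact: ba.
  by case: (@no_cycle1 a); apply: ba; rewrite -{1}ca.
have Hran b r' : sub b a -> (forall u, E u r' <-> exists2 c, E c b & Rec c u) ->
    is_range r' f b.
  move=> ba Hr' u; rewrite Hr'; split=> -[c cb cu]; exists c => //.
    exact/(Hf' c b).
  exact/(Hf' c b).
have tot' b c : sub b a -> E c b -> exists u, E (opair c u) f.
  move=> ba cb; have [u cu] := tot c (ba _ cb); exists u; exact/(Hf' c b).
exists f; split; last by apply/Hf; right.
move=> b u /Hf[[ba bu]|[-> ->]]; last first.
  split=> // [c ca|]; first exact: (tot' a).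
  by exists r; split=> //; exact: Hran.
have sba : sub b a by move=> c cb; exact: ord_trans cb.
have ob := ord_in oa ba.
split=> // [c cb|]; first exact: (tot' b).
have [r' Hr'] := Rec_range ob; exists r'; split; first exact: Hran.
exact: Rec_unfold.
Qed.

Lemma Rec_total : (forall a r, ord a -> exists y, H a r y) ->
  forall a, ord a -> exists y, Rec a y.
Proof.
move=> totH; have dR := def_Rec; apply: ord_ind.
  by have [_ [w _]] := dR; have d := w 0; definability.
move=> a oa IH; have [r Hr] := Rec_range oa; have [y Hy] := totH a r oa.
by exists y; exact: Rec_fold Hr Hy.
Qed.

End Recursion.

(** * Transitive supersets and the cumulative hierarchy *)

Lemma transitive_superset a : exists t, transitive_in t /\ sub a t.
Proof.
(* Each stage consists of [a] and the elements of elements of earlier stages. A limit stage is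
   transitive, since an element present at some stage has its own elements added at the next. *)
pose H (b r t : M) := forall z, E z t <->
  E z a \/ exists2 y, E y r & exists2 x, E x y & E z x.
have d := a.
have dH : def3 H by cbv delta [H]; definability.
have fH b r y y' : H b r y -> H b r y' -> y = y'.
  by move=> Hy Hy'; apply: ext_in => z; rewrite Hy Hy'.
have tH b r : ord b -> exists y, H b r y.
  move=> _; exists (Union (upr a (Union (Union r)))) => z; rewrite UnionP; split.
    move=> [y /uprP[->|->]]; first by left.
    by move=> /UnionP[x /UnionP[y' y'r xy'] zx]; right; exists y' => //; exists x.
  move=> [za|[y yr [x xy zx]]]; first by exists a => //; apply/uprP; left.
  exists (Union (Union r)); first by apply/uprP; right.
  by apply/UnionP; exists x => //; apply/UnionP; exists y.
have tot := Rec_total dH fH tH.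
have key b t z : ord b -> Rec H b t -> E z t <-> E z a \/
    exists2 c, E c b & exists y, Rec H c y /\ exists2 x, E x y & E z x.
  move=> ob bt; have [r Hr] := Rec_range dH fH ob.
  rewrite (Rec_unfold fH Hr bt); split=> -[|]; try by left.
    by move=> [y /Hr[c cb cy] Hz]; right; exists c => //; exists y.
  by move=> [c cb [y [cy Hz]]]; right; exists y => //; apply/Hr; exists c.
have [l ol [[b0 b0l] sl]] := limit_ordinal.
have [t lt] := tot l ol; exists t; split; last by move=> z za; apply/(key l); auto.
move=> x /(key l _ _ ol lt) Hx z zx; apply/(key l _ _ ol lt); right.
case: Hx => [xa|[c cl [y [cy Hy]]]].
  have ob0 := ord_in ol b0l.
  exists b0 => //; have [y b0y] := tot b0 ob0; exists y; split=> //.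
  by exists x => //; apply/(key b0); auto.
(* By stage c + 1 the set [x] itself has appeared, so its element [z] enters at the limit. *)
exists (adj c c); first exact: sl.
have oc := ord_succ (ord_in ol cl).
have [y' Hy'] := tot _ oc; exists y'; split=> //; exists x => //.
by apply/(key (adj c c)) => //; right; exists c; [apply/adjP; right|exists y].
Qed.

(** The von Neumann hierarchy: V_a is the union of the power sets of the V_b with b < a, and
    [inV a z] says that z lies in V_a. *)
Definition V_step (b r v : M) := forall z, E z v <-> exists2 y, E y r & sub z y.

Definition inV a z := exists v, Rec V_step a v /\ E z v.

Lemma def_V_step : M -> def3 V_step.
Proof. by move=> d; cbv delta [V_step subset_in]; definability. Qed.

Lemma V_step_fun b r y y' : V_step b r y -> V_step b r y' -> y = y'.
Proof. by move=> Hy Hy'; apply: ext_in => z; rewrite Hy Hy'. Qed.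

Lemma def_inV t u : term t -> term u -> def (fun e => inV (t e) (u e)).
Proof.
move=> Ht; have [_ [w _]] := Ht; apply: dfn_app2 Ht; have d := w 0.
by have dR := def_Rec (def_V_step d); cbv delta [inV]; definability.
Qed.

Lemma V_total a : ord a -> exists v, Rec V_step a v.
Proof.
apply: (Rec_total (def_V_step a) V_step_fun) => b r ob.
have [|v Hv] := sep_ex (P := fun z => exists2 y, E y r & sub z y) _ (Pow (Union r)).
  by cbv delta [subset_in]; definability.
exists v => z; rewrite Hv; split=> [[]//|Hz]; split=> //; apply/PowP => x xz.
by have [y yr zy] := Hz; apply/UnionP; exists y => //; exact: zy.
Qed.

Lemma V_set a : ord a -> exists v, forall z, E z v <-> inV a z.
Proof.
move=> oa; have [v Hv] := V_total oa; exists v => z.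
split=> [zv|[v' [Hv' zv']]]; first by exists v.
by rewrite (Rec_fun V_step_fun Hv Hv').
Qed.

Lemma inVP a z : ord a -> inV a z <-> exists2 b, E b a & forall x, E x z -> inV b x.
Proof.
move=> oa; have [r Hr] := Rec_range (def_V_step a) V_step_fun oa.
split=> [[v [Hv zv]]|[b ba Hb]].
  have [y yr zy] := (Rec_unfold V_step_fun Hr Hv z).1 zv.
  have [b ba by_] := (Hr y).1 yr.
  by exists b => // x xz; exists y; split=> //; exact: zy.
have [v Hv] := V_total oa; exists v; split=> //.
apply/(Rec_unfold V_step_fun Hr Hv).
have [y Hy] := V_total (ord_in oa ba); exists y; first by apply/Hr; exists b.
by move=> x /Hb[y' [Hy' xy']]; rewrite (Rec_fun V_step_fun Hy Hy').
Qed.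

Lemma inV_mono a b z : ord a -> E b a -> inV b z -> inV a z.
Proof.
move=> oa ba; rewrite !inVP //; last exact: ord_in ba.
by move=> [c cb Hc]; exists c => //; apply: ord_trans cb.
Qed.

Ltac dfn_hook ::= first [apply def_ord | apply term_opair | apply def_inV].

(** Inside a transitive set containing [z], take a minimal set without rank: its elements have
    ranks, which collection bounds, so it has a rank as well. *)
Lemma inV_all z : exists2 a, ord a & inV a z.
Proof.
apply: contrapT => nz; have [t [tt zt]] := transitive_superset (upr z z).
have [|B HB] := sep_ex (P := fun x => ~ exists2 a, ord a & inV a x) _ t.
  by have d := z; definability.
have [|x /HB[xt nx] Hx] := zf_foundation hZF (a := B).
  by exists z; apply/HB; split=> //; apply: zt; apply/uprP; left.
apply: nx; have [|||a oa Ha] := @ord_collection (fun y a => inV a y) x.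
- by have d := z; definability.
- move=> y yx; apply: contrapT => ny; apply: (Hx y); split=> //; apply/HB.
  by split=> //; apply: (tt x).
- by move=> y c b ob cb; exact: inV_mono.
exists (adj a a); first exact: ord_succ.
by apply/inVP; [exact: ord_succ|exists a => //; apply/adjP; right].
Qed.

End SetTheory.

(** * Enumerations and distributivity *)

Section Choice.
Variables (M : Type) (E : M -> M -> Prop).
Hypothesis hZF : ZF E.

Local Notation def := (@dfn M E 0 (fun=> set0)).
Local Notation term := (@tdf M E 0 (fun=> set0)).
Local Notation def1 := (@dfn1 M E 0 (fun=> set0)).
Local Notation def2 := (@dfn2 M E 0 (fun=> set0)).
Local Notation def3 := (@dfn3 M E 0 (fun=> set0)).
Local Notation sub := (subset_in E).
Local Notation ord := (ord E).
Local Notation opair := (opair hZF).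
Local Notation inV := (inV hZF).
Local Notation adj := (adj hZF).
Local Notation Union := (Union hZF).
Local Notation Pow := (Pow hZF).
Local Notation Rec := (Rec hZF).
Ltac dfn_hook ::= first [apply def_ord | apply term_opair | apply def_inV].

Lemma enumeration_of_wellorder R : def2 R -> global_well_order E R ->
  exists F, [/\ def2 F, forall b y y', F b y -> F b y' -> y = y',
    forall b, ord b <-> exists y, F b y,
    forall b c y, F b y -> F c y -> b = c & forall y, exists b, F b y].
Proof.
move=> dR [irr trR _ minR].
pose new c (r z : M) := inV c z /\ ~ E z r.
pose H (i r y : M) := exists c, [/\ ord c, forall b, E b c -> ~ exists z, new b r z,
  new c r y & forall z, new c r z -> y = z \/ R y z].
have [d _] := zf_infinity hZF.
have dn : def3 new by cbv delta [new]; definability.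
have dH : def3 H by cbv delta [H]; definability.
have fH i r y y' : H i r y -> H i r y' -> y = y'.
  move=> [c [oc Hc cy Hy]] [c' [oc' Hc' cy' Hy']].
  have cc' : c = c'.
    case: (ord_tri hZF oc oc') => [/Hc'[]|[//|/Hc[]]]; first by exists y.
    by exists y'.
  rewrite -cc' in cy' Hy'; case: (Hy _ cy') => // yy'.
  by case: (Hy' _ cy) => // /(trR _ _ _ yy') /irr.
have tH i r : ord i -> exists y, H i r y.
  move=> _; have [x xr] := no_universe hZF r; have [a oa ax] := inV_all hZF x.
  have [||b [ob [z bz] Hb]] :=
      @ord_least _ _ hZF (fun c => exists z, new c r z) a _ oa.
  - by definability.
  - by exists x.
  have [||y by_ Hy] := minR (new b r); last by exists y, b; split.
    by apply/definable_classP; definability.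
  by exists z.
have tot := Rec_total hZF dH fH tH; have dF := def_Rec hZF dH.
have Fval := @Rec_val _ _ hZF _ dH fH.
have lt_neq b c y : Rec H b y -> Rec H c y -> ~ E b c.
  move=> Fb /Fval[r [Hr [g [_ _ [_ yr] _]]]] bc.
  by apply: yr; apply/Hr; exists b.
have inj b c y : Rec H b y -> Rec H c y -> b = c.
  move=> Fb Fc; case: (ord_tri hZF (Rec_ord Fb) (Rec_ord Fc)) => [|[//|]] /lt_neq.
    by move=> /(_ y Fb Fc).
  by move=> /(_ y Fc Fb).
exists (Rec H); split=> //.
- exact: Rec_fun.
- by move=> b; split=> [/tot//|[y]]; exact: Rec_ord.
- move=> x; apply: contrapT => nx; have [a oa ax] := inV_all hZF x.
  have [v Hv] := V_set hZF oa.
  apply: (no_ord_injection hZF (F := Rec H) (a := v)) => //; last first.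
    by move=> b c y _ _; exact: inj.
  move=> b ob; have [y Fy] := tot b ob; exists y => //; apply/Hv.
  have [r [Hr [c [oc Hc [cy _] _]]]] := Fval b y Fy.
  case: (ord_tri hZF oc oa) => [ca|[<- //|/Hc[]]]; first exact: inV_mono cy.
  by exists x; split=> // /Hr[e _ Fe]; apply: nx; exists e.
Qed.

(** * Consequences of the axiom of choice for sets *)

Hypothesis hAC : choice_axiom E.

(** The choice axiom speaks of disjoint families, so each [s] is replaced by its tagged copy {s} ×
    s. *)
Lemma choice_function S : (forall s, E s S -> nonempty_in E s) ->
  exists c, forall s, E s S ->
    exists2 y, E y s & forall z, E z s -> E (opair s z) c <-> z = y.
Proof.
move=> HS; have d := S.
have pf s : exists t, forall z, E z t <-> exists2 y, E y s & z = opair s y.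
  apply: (repl_ex hZF (P := fun y z => z = opair s y)); first by definability.
  by move=> x y y' _ -> ->.
have [||T HT] := repl_ex hZF (P := fun s t =>
    forall z, E z t <-> exists2 y, E y s & z = opair s y) _ (a := S).
- by definability.
- by move=> s t t' _ Ht Ht'; apply: (ext_in hZF) => z; rewrite Ht Ht'.
have [||c Hc] := hAC (a := T).
- move=> t /HT[s sS Ht]; have [y ys] := HS s sS.
  by exists (opair s y); apply/Ht; exists y.
- move=> t t' z /HT[s sS Ht] /HT[s' sS' Ht'] /Ht[y ys ->] /Ht'[y' ys'].
  move=> zz; have [ss' _] := opair_inj zz; apply: (ext_in hZF) => u; rewrite Ht Ht'.
  by rewrite ss'.
exists c => s sS; have [t Ht] := pf s.
have [|z [[zt zc] zu]] := Hc t; first by apply/HT; exists s.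
have [y ys zE] := (Ht z).1 zt; exists y => // u us.
split=> [uc|->]; last by rewrite -zE.
have : z = opair s u by apply: zu; split=> //; apply/Ht; exists u.
by rewrite zE => zz; have [] := opair_inj zz.
Qed.

(** Zermelo's argument: keep choosing from what is left of [a]. The recursion must stop, as
    otherwise the ordinals would inject into [a]; [k] is the first stage without a value. *)
Lemma well_enumeration a : exists k e,
  [/\ ord k, def2 e, forall i x x', e i x -> e i x' -> x = x',
      forall i, E i k -> exists2 x, E x a & e i x
    & forall x, E x a -> exists2 i, E i k & e i x].
Proof.
have d := a.
have [|S HS] := sep_ex hZF (P := nonempty_in E) _ (Pow a).
  by cbv delta [nonempty_in]; definability.
have [|c Hc] := @choice_function S; first by move=> s /HS[].
pose H (i r y : M) := exists s, [/\ forall z, E z s <-> E z a /\ ~ E z r, E y s &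
  E (opair s y) c].
have dH : def3 H by cbv delta [H]; definability.
have inS r s y : (forall z, E z s <-> E z a /\ ~ E z r) -> E y s -> E s S.
  move=> Hs ys; apply/HS; split; last by exists y.
  by apply/PowP => z /Hs[].
have fH i r y y' : H i r y -> H i r y' -> y = y'.
  move=> [s [Hs ys yc]] [s' [Hs' ys' yc']].
  have ss' : s' = s by apply: (ext_in hZF) => z; rewrite Hs Hs'.
  rewrite ss' in ys' yc'.
  have [y0 _ Hy0] := Hc s (inS _ _ _ Hs ys).
  by rewrite ((Hy0 y ys).1 yc) ((Hy0 y' ys').1 yc').
have dF := def_Rec hZF dH.
have Fval := @Rec_val _ _ hZF _ dH fH.
have lt_neq b b' y : Rec H b y -> Rec H b' y -> ~ E b b'.
  move=> Fb /Fval[r [Hr [s [Hs ys _]]]] bc.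
  by have [_] := (Hs y).1 ys; apply; apply/Hr; exists b.
have Fa b y : Rec H b y -> E y a.
  by move=> /Fval[r [_ [s [Hs /Hs[]]]]].
have [k0 ok0 nk0] : exists2 k, ord k & ~ exists y, Rec H k y.
  apply: contrapT => tot; apply: (no_ord_injection hZF (F := Rec H) (a := a)) => //.
    move=> b ob; have [y Fy] : exists y, Rec H b y.
      by apply: contrapT => nb; apply: tot; exists b.
    by exists y => //; exact: Fa Fy.
  move=> b b' y ob ob' Fb Fb'; case: (ord_tri hZF ob ob') => [|[//|]] /lt_neq.
    by move=> /(_ y Fb Fb').
  by move=> /(_ y Fb' Fb).
have [|k [ok nk Hk]] :=
    @ord_least _ _ hZF (fun k => ~ exists y, Rec H k y) _ _ ok0 nk0.
  by definability.
exists k, (Rec H); split=> //.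
- exact: Rec_fun.
- by move=> i /Hk/contrapT[x Fx]; exists x => //; exact: Fa Fx.
- move=> x xa; have [r Hr] := Rec_range hZF dH fH ok; apply/Hr.
  (* An element left over would give stage [k] a value. *)
  apply: contrapT => xr; apply: nk.
  have [|s Hs] := sep_ex hZF (P := fun z => ~ E z r) _ a; first by definability.
  have [|y ys Hy] := Hc s; first by apply: (inS r s x) => //; apply/Hs.
  exists y; apply: (Rec_fold dH fH ok _ Hr); first by move=> b /Hk/contrapT.
  by exists s; split=> //; apply/(Hy _ ys).
Qed.

Section Distributivity.
Variables (cond : M -> Prop) (D : M -> M -> Prop) (a p : M).
Hypotheses (dcond : def1 cond) (dD : def2 D)
  (chain : forall C, (forall q, E q C -> cond q) ->
    (forall q q', E q C -> E q' C -> sub q q' \/ sub q' q) -> cond (Union C))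
  (dense : forall x q, E x a -> cond q ->
    exists q', [/\ cond q', sub q q' & D x q'])
  (dopen : forall x q q', E x a -> cond q -> cond q' -> sub q q' -> D x q -> D x q')
  (condp : cond p).

Let subV q c := forall z, E z q -> inV c z.

Let subV_mono q b c : ord b -> E c b -> subV q c -> subV q b.
Proof. by move=> ob cb qc z /qc; exact: inV_mono. Qed.

Let subV_ex q : exists2 c, ord c & subV q c.
Proof.
have [b ob /(inVP _ _ ob)[c cb Hc]] := inV_all hZF q.
by exists c => //; exact: ord_in cb.
Qed.

Let dsubV : def2 subV.
Proof. by have d := p; cbv delta [subV]; definability. Qed.

(* Without global choice one cannot choose extensions along a chain of length
   [|a|] directly. The ordinals [L i] bound, level by level, where extensions
   of all conditions of the previous levels can be found; the choices then
   happen inside a set. *)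
Lemma distributivity : exists q, [/\ cond q, sub p q & forall x, E x a -> D x q].
Proof.
have d := p.
have [c0 oc0 pc0] := subV_ex p.
(* With [r] the earlier bounds, a small condition stays within their levels and the level [c0] of
   [p]; [HL] picks the least level holding extensions of all such conditions into every [D x]. *)
pose small r q := forall z, E z q ->
  inV c0 z \/ exists b, [/\ E b r, ord b & inV b z].
pose good r c := forall q, cond q -> small r q -> forall x, E x a ->
  exists q', [/\ cond q', sub q q', D x q' & subV q' c].
pose HL (i r c : M) := [/\ ord c, good r c & forall b, E b c -> ~ good r b].
have dgood : def2 good by cbv delta [good small subset_in]; definability.
have dHL : def3 HL by cbv delta [HL]; definability.
have fHL i r y y' : HL i r y -> HL i r y' -> y = y'.
  by move=> [oy gy Hy] [oy' gy' Hy']; case: (ord_tri hZF oy oy') => [/Hy'|[|/Hy]].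
have tHL i r : ord i -> exists y, HL i r y.
  move=> _.
  (* A common bound of [c0] and the ordinals in [r] puts all small conditions into one power set. *)
  have [|S HS] := sep_ex hZF (P := ord) _ (adj r c0); first by definability.
  have [|b ob Hb] := @ord_bound _ _ hZF S; first by move=> x /HS[].
  have [v Hv] := V_set hZF ob.
  have sm q : small r q -> E q (Pow v).
    move=> Hq; apply/PowP => z /Hq[zc|[c [cr oc zc]]]; apply/Hv.
      apply: (inV_mono ob _ zc); apply: Hb; apply/HS; split=> //.
      by apply/adjP; right.
    apply: (inV_mono ob _ zc); apply: Hb; apply/HS; split=> //.
    by apply/adjP; left.
  (* Collection is used twice: over the subsets of that level and, for each of them, over [a]. *)
  have [|||c oc Hc] := @ord_collection _ _ hZF (fun q c =>
     cond q -> small r q -> forall x, E x a ->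
     exists q', [/\ cond q', sub q q', D x q' & subV q' c]) (Pow v).
  - by cbv delta [small subset_in]; definability.
  - move=> q _; case: (pselect (cond q)) => [cq|]; last by exists c0.
    have [|||c oc Hc] := @ord_collection _ _ hZF (fun x c =>
      exists q', [/\ cond q', sub q q', D x q' & subV q' c]) a; last by exists c.
    + by cbv delta [subset_in]; definability.
    + move=> x xa; have [q' [cq' qq' Dq']] := dense xa cq.
      by have [c oc Hc] := subV_ex q'; exists c => //; exists q'.
    + move=> x c b' ob' cb' [q' [? ? ? ?]]; exists q'; split=> //.
      exact: subV_mono cb' _.
  - move=> q c b' ob' cb' Hq cq sq x xa; have [q' [? ? ? ?]] := Hq cq sq x xa.
    by exists q'; split=> //; exact: subV_mono cb' _.
  have gc : good r c by move=> q cq sq; exact: Hc (sm _ sq) cq sq.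
  have [|m [om gm Hm]] := @ord_least _ _ hZF (good r) c _ oc gc.
    by definability.
  by exists m.
have totL := Rec_total hZF dHL fHL tHL.
have dL := def_Rec hZF dHL.
set L := Rec HL in totL dL.
have Lord i c : L i c -> ord c by move=> /(Rec_val dHL fHL)[r [_ []]].
have [k [e [ok de fe ek ke]]] := well_enumeration a.
(* All levels [L i] with i < k lie inside V_b, so a choice function on families of subsets of [v]
   serves every stage. *)
have [rk Hrk] := Rec_range hZF dHL fHL ok.
have [|b ob Hb] := @ord_bound _ _ hZF rk; first by move=> c /Hrk[i _ /Lord].
have [v Hv] := V_set hZF ob.
have [|S HS] := sep_ex hZF (P := nonempty_in E) _ (Pow (Pow v)).
  by cbv delta [nonempty_in]; definability.
have [|c Hc] := @choice_function S; first by move=> s /HS[].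
(* Candidates for stage [i] extend [p] and all earlier choices and meet [D] at the [i]-th element;
   staying within level [L i] keeps later unions small. *)
pose K i r q := [/\ cond q, sub p q, forall q0, E q0 r -> sub q0 q,
  forall x, e i x -> D x q & exists c, L i c /\ subV q c].
have dK : def3 K by cbv delta [K subset_in]; definability.
pose H (i r y : M) := exists s,
  [/\ forall q, E q s <-> E q (Pow v) /\ K i r q, E y s & E (opair s y) c].
have dH : def3 H by cbv delta [H]; definability.
have inS i r s y : (forall q, E q s <-> E q (Pow v) /\ K i r q) -> E y s -> E s S.
  move=> Hs ys; apply/HS; split; last by exists y.
  by apply/PowP => z /Hs[].
have fH i r y y' : H i r y -> H i r y' -> y = y'.
  move=> [s [Hs ys yc]] [s' [Hs' ys' yc']].
  have ss' : s' = s by apply: (ext_in hZF) => z; rewrite Hs Hs'.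
  rewrite ss' in ys' yc'.
  have [y0 _ Hy0] := Hc s (inS _ _ _ _ Hs ys).
  by rewrite ((Hy0 y ys).1 yc) ((Hy0 y' ys').1 yc').
have dF := def_Rec hZF dH.
set F := Rec H in dF.
have Fval i y : F i y -> exists r,
    (forall u, E u r <-> exists2 j, E j i & F j u) /\ K i r y.
  move=> /(Rec_val dH fH)[r [Hr [s [Hs ys _]]]]; exists r; split=> //.
  by have [] := (Hs y).1 ys.
have Fmono i j q q' : E i j -> F i q -> F j q' -> sub q q'.
  by move=> ij Fi /Fval[r [Hr [_ _ Hq' _ _]]]; apply: Hq'; apply/Hr; exists i.
(* Including [p] among the earlier choices covers the first stage and puts [p] inside every
   union. *)
have Ucond i r : (forall u, E u r <-> exists2 j, E j i & F j u) ->
    cond (Union (adj r p)).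
  move=> Hr; apply: chain => [q|q q'].
    by move=> /adjP[/Hr[j _ /Fval[r' [_ []]]]|->].
  move=> /adjP[/Hr[j _ Fj]|->] /adjP[/Hr[j' _ Fj']|->].
  - case: (ord_tri hZF (Rec_ord Fj) (Rec_ord Fj')) => [jj'|[jj'|jj']].
    + by left; exact: Fmono Fj Fj'.
    + by left; rewrite jj' in Fj; rewrite (Rec_fun fH Fj Fj') => x.
    + by right; exact: Fmono Fj' Fj.
  - by right; have [r' [_ [_ pq _ _ _]]] := Fval _ _ Fj.
  - by left; have [r' [_ [_ pq _ _ _]]] := Fval _ _ Fj'.
  - by left; move=> x.
have Usub r q : E q (adj r p) -> sub q (Union (adj r p)).
  by move=> qr x xq; apply/UnionP; exists q.
have Ftot i : ord i -> E i k -> exists y, F i y.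
  move: i; apply: (@ord_ind _ _ hZF (fun i => E i k -> exists y, F i y)).
    by definability.
  move=> i oi IH ik; have [r Hr] := Rec_range hZF dH fH oi.
  have [rL HrL] := Rec_range hZF dHL fHL oi.
  have [g Lg] := totL i oi; have [og gg _] := Rec_unfold fHL HrL Lg.
  have [x xa eix] := ek i ik.
  (* The union of the earlier choices is small because each lies in its own level, so the bound for
     stage [i] provides an extension. *)
  have [|q' [cq' uq' Dq' q'V]] := gg (Union (adj r p)) (Ucond _ _ Hr) _ x xa.
    move=> z /UnionP[q /adjP[/Hr[j ji Fj]|->] zq]; last by left; exact: pc0.
    right; have [_ [_ [_ _ _ _ [h [Lh qh]]]]] := Fval _ _ Fj.
    exists h; split; [|exact: Lord Lh|exact: qh].
    by apply/HrL; exists j.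
  have Kq' : K i r q'.
    split=> //.
    - by move=> z zp; apply: uq'; apply: Usub zp; apply/adjP; right.
    - by move=> q0 q0r z zq; apply: uq'; apply: Usub zq; apply/adjP; left.
    - by move=> x' eix'; rewrite -(fe _ _ _ eix eix').
    - by exists g.
  have [|s Hs] := sep_ex hZF (P := K i r) _ (Pow v); first by definability.
  have q's : E q' s.
    apply/Hs; split=> //; apply/PowP => z /q'V zg; apply/Hv.
    by apply: (inV_mono ob _ zg); apply: Hb; apply/Hrk; exists i.
  have [y ys Hy] := Hc s (inS _ _ _ _ Hs q's).
  exists y; apply: (Rec_fold dH fH oi _ Hr).
    by move=> j ji; apply: IH => //; exact: ord_trans ji.
  by exists s; split=> //; apply/(Hy _ ys).
have [r Hr] := Rec_range hZF dH fH ok.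
exists (Union (adj r p)); split; first exact: Ucond Hr.
  by apply: Usub; apply/adjP; right.
move=> x xa; have [i ik eix] := ke x xa.
have [y Fy] := Ftot i (ord_in hZF ok ik) ik.
have [_ [_ [cy _ _ Dy _]]] := Fval _ _ Fy.
apply: (dopen xa cy (Ucond _ _ Hr) _ (Dy _ eix)).
by apply: Usub; apply/adjP; left; apply/Hr; exists i.
Qed.

End Distributivity.

End Choice.

(** * Forcing *)

Lemma sat_bound M (E : M -> M -> Prop) k (W : 'I_k -> set M) (f : formula k) :
  exists N, forall v v', (forall n, n < N -> v n = v' n) ->
    sat E W v f <-> sat E W v' f.
Proof.
elim: f => [i j|i j|i c||g [N HN] h [N' HN']|g [N HN]] /=.
- by exists (maxn i j).+1 => v v' H; rewrite !H // ltnS ?leq_maxl ?leq_maxr.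
- by exists (maxn i j).+1 => v v' H; rewrite !H // ltnS ?leq_maxl ?leq_maxr.
- by exists i.+1 => v v' H; rewrite H.
- by exists 0.
- exists (maxn N N') => v v' H; rewrite (HN v v') ?(HN' v v') // => n Hn;
  by apply: H; rewrite leq_max Hn ?orbT.
- exists N => v v' H; suff HNx x : sat E W (scons x v) g <-> sat E W (scons x v') g.
    by split=> Hv x; apply/HNx.
  by apply: HN => -[//|n] Hn /=; apply: H; exact: ltnW.
Qed.

(** A formula reads finitely many parameters; storing them in a sequence makes the definitions
    countable in number when [M] is countable. *)
Lemma dfn1_seqP M (E : M -> M -> Prop) k (W : 'I_k -> set M) (d : M) A :
  dfn1 E W A -> exists (f : formula k) (s : seq M),
    forall x, A x <-> sat E W (scons x (nth d s)) f.
Proof.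
move=> /dfn1P[f [v Hf]]; have [N HN] := sat_bound E W f.
exists f, (mkseq v N) => x; rewrite Hf; apply: HN => -[//|n] Hn /=.
by rewrite nth_mkseq // ltnW.
Qed.

Lemma scons_nth (M : Type) (d x : M) s : scons x (nth d s) = nth d (x :: s).
Proof. by apply/funext; case. Qed.

(** An encoding into a countable type, through which [pickle] can number formulas. *)
Fixpoint formula_tree k (f : formula k) : GenTree.tree nat :=
  match f with
  | FMem i j => GenTree.Node 0 [:: GenTree.Leaf i; GenTree.Leaf j]
  | FEq i j => GenTree.Node 1 [:: GenTree.Leaf i; GenTree.Leaf j]
  | FCls i c => GenTree.Node 2 [:: GenTree.Leaf i; GenTree.Leaf (c : nat)]
  | FFalse => GenTree.Node 3 [::]
  | FImp g h => GenTree.Node 4 [:: formula_tree g; formula_tree h]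
  | FAll g => GenTree.Node 5 [:: formula_tree g]
  end.

Lemma formula_tree_inj k : injective (@formula_tree k).
Proof.
elim=> [i j|i j|i c||g IHg h IHh|g IHg] [i' j'|i' j'|i' c'||g' h'|g'] //=.
- by case=> -> ->.
- by case=> -> ->.
- by case=> -> /val_inj ->.
- by case=> /IHg -> /IHh ->.
- by case=> /IHg ->.
Qed.

Section Forcing.
Variables (M : Type) (E : M -> M -> Prop).
Hypotheses (hZF : ZF E) (hAC : choice_axiom E).

Local Notation def := (@dfn M E 0 (fun=> set0)).
Local Notation def1 := (@dfn1 M E 0 (fun=> set0)).
Local Notation def2 := (@dfn2 M E 0 (fun=> set0)).
Local Notation sub := (subset_in E).
Local Notation ord := (ord E).
Local Notation opair := (opair hZF).
Local Notation opairI := (@opair_inj M E hZF _ _ _ _).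
Local Notation adj := (adj hZF).
Local Notation Union := (Union hZF).

Ltac dfn_hook ::= first [apply def_ord | apply term_opair | apply def_inV].

(** * Conditions and the forcing relation *)

Definition cond p := [/\ forall z, E z p -> exists x b, ord b /\ z = opair x b,
  forall x b c, E (opair x b) p -> E (opair x c) p -> b = c &
  forall x y b, E (opair x b) p -> E (opair y b) p -> x = y].

Lemma def_cond : def1 cond.
Proof.
have [d _] := zf_infinity hZF; cbv delta [cond]; definability.
Qed.

Lemma sub_trans p q r : sub p q -> sub q r -> sub p r.
Proof. by move=> pq qr x /pq/qr. Qed.

Lemma cond_chain C : (forall q, E q C -> cond q) ->
  (forall q q', E q C -> E q' C -> sub q q' \/ sub q' q) -> cond (Union C).
Proof.
move=> HC ch.
have common u v : E u (Union C) -> E v (Union C) ->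
    exists q, [/\ E q C, E u q & E v q].
  move=> /UnionP[q qC uq] /UnionP[q' q'C vq'].
  case: (ch _ _ qC q'C) => H; [exists q'|exists q]; split=> //; exact: H.
split=> [z /UnionP[q qC zq]|x b c|x y b].
- by have [H _ _] := HC q qC; exact: H.
- by move=> bC /(common _ _ bC)[q [/HC[_ H _] bq cq]]; exact: H bq cq.
- by move=> bC /(common _ _ bC)[q [/HC[_ _ H] bq cq]]; exact: H bq cq.
Qed.

Lemma cond_empty : exists p, cond p.
Proof.
have [w [[p _ np] _]] := zf_infinity hZF; exists p.
by split=> [z zp|x b c zp|x y b zp]; case: np;
   [exists z|exists (opair x b)|exists (opair x b)].
Qed.

Lemma cond_adj p x b : cond p -> ord b -> (forall c, ~ E (opair x c) p) ->
  (forall y, ~ E (opair y b) p) -> cond (adj p (opair x b)).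
Proof.
move=> [c1 c2 c3] ob nx nb; split=> [z|y c c'|y y' c].
- by move=> /adjP[/c1//|->]; exists x, b.
- move=> /adjP[yc|/opairI[-> ->]] /adjP[yc'|H'].
  + exact: c2 yc yc'.
  + by move: yc; have [-> _] := opair_inj H' => /nx.
  + by move: yc' => /nx.
  + by have [_ ->] := opair_inj H'.
- move=> /adjP[yc|/opairI[-> ->]] /adjP[yc'|H'].
  + exact: c3 yc yc'.
  + by move: yc; have [_ ->] := opair_inj H' => /nb.
  + by move: yc' => /nb.
  + by have [-> _] := opair_inj H'.
Qed.

(** The ordinals used by [p] form a set, so a fresh one is available as value of [x] and injectivity
    is kept. *)
Lemma cond_dom p x : cond p ->
  exists q, [/\ cond q, sub p q & exists b, E (opair x b) q].
Proof.
move=> cp; have d := p; case: (pselect (exists b, E (opair x b) p)) => [|nx].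
  by exists p; split.
have [||r Hr] := repl_ex hZF (P := fun z b => exists y, z = opair y b) _ (a := p).
- by definability.
- by move=> z b b' _ [y ->] [y' H]; have [_ ->] := opair_inj H.
have [b ob br] := ord_unbounded hZF r.
exists (adj p (opair x b)); split.
- apply: cond_adj => // [c xc|y yb]; first by apply: nx; exists c.
  by apply: br; apply/Hr; exists (opair y b) => //; exists y.
- by move=> z zp; apply/adjP; left.
- by exists b; apply/adjP; right.
Qed.

Lemma cond_ran p b : cond p -> ord b ->
  exists q, [/\ cond q, sub p q & exists x, E (opair x b) q].
Proof.
move=> cp ob; have d := p; case: (pselect (exists x, E (opair x b) p)) => [|nb].
  by exists p; split.
have [||r Hr] := repl_ex hZF (P := fun z y => exists c, z = opair y c) _ (a := p).
- by definability.
- by move=> z y y' _ [c ->] [c' H]; have [-> _] := opair_inj H.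
have [x xr] := no_universe hZF r.
exists (adj p (opair x b)); split.
- apply: cond_adj => // [c xc|y yb]; last by apply: nb; exists y.
  by apply: xr; apply/Hr; exists (opair x c) => //; exists c.
- by move=> z zp; apply/adjP; left.
- by exists x; apply/adjP; right.
Qed.

(* No new sets are added, so the forcing language needs no names: its
   quantifiers range over the ground model and only the generic class is
   approximated by conditions. *)
Fixpoint force (f : formula 1) (p : M) (e : nat -> M) : Prop :=
  match f with
  | FMem i j => E (e i) (e j)
  | FEq i j => e i = e j
  | FCls i _ => forall q, cond q -> sub p q ->
      exists r, [/\ cond r, sub q r & E (e i) r]
  | FFalse => False
  | FImp g h => forall q, cond q -> sub p q -> force g q e -> force h q e
  | FAll g => forall x, force g p (scons x e)
  end.

Definition force_not f p e := forall q, cond q -> sub p q -> ~ force f q e.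

Lemma force_mono f p q e : sub p q -> force f p e -> force f q e.
Proof.
elim: f p q e => //= [i _|g _ h _|g IHg] p q e pq H.
- by move=> r cr /(sub_trans pq); exact: H.
- by move=> r cr /(sub_trans pq); exact: H.
- by move=> x; exact: IHg pq (H x).
Qed.

Lemma force_not_mono f p q e : sub p q -> force_not f p e -> force_not f q e.
Proof. by move=> pq H r cr /(sub_trans pq); exact: H. Qed.

(** The class atom is forced by density, and falsity, implication and universal quantification
    preserve stability. Its use is to produce a refuted instance when a universal formula is not
    forced. *)
Lemma force_stable f p e : cond p ->
  (forall q, cond q -> sub p q -> ~ force_not f q e) -> force f p e.
Proof.
move=> cp H; have {H} : forall q, cond q -> sub p q ->
    exists r, [/\ cond r, sub q r & force f r e].
  move=> q cq pq; apply: contrapT => nr; apply: (H q cq pq) => r cr qr fr.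
  by apply: nr; exists r.
elim: f p e cp => [i j|i j|i c||g _ h IHh|g IHg] p e cp H /=;
  try by have [|r []] := H p cp.
- move=> q cq pq; have [r [cr qr /(_ r cr)[//|s [cs rs xs]]]] := H q cq pq.
  by exists s; split=> //; exact: sub_trans rs.
- move=> q cq pq fg; apply: IHh => // q' cq' qq'.
  have [r [cr q'r fr]] := H q' cq' (sub_trans pq qq').
  exists r; split=> //; apply: fr => //.
  exact: force_mono (sub_trans qq' q'r) fg.
- move=> x; apply: IHg => // q cq pq; have [r [cr qr fr]] := H q cq pq.
  by exists r; split.
Qed.

Lemma force_or_not f p e : cond p ->
  exists q, [/\ cond q, sub p q & force f q e \/ force_not f q e].
Proof.
move=> cp; case: (pselect (force_not f p e)) => [H|].
  by exists p; split=> //; right.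
move=> /existsNP[q /not_implyP[cq /not_implyP[pq /contrapT H]]].
by exists q; split=> //; left.
Qed.

(** Induction on [f] outside the model: each formula has its own definition of forcing, with
    variable 0 holding the condition. *)
Lemma def_force f : def (fun e => force f (e 0) (fun n => e n.+1)).
Proof.
have [d _] := zf_infinity hZF; have dc := def_cond.
elim: f => [i j|i j|i c||g IHg h IHh|g IHg] /=.
- by definability.
- by definability.
- by cbv delta [subset_in]; definability.
- by definability.
- apply: dfn_all; apply: dfn_imp; first by definability.
  apply: dfn_imp; first by cbv delta [subset_in]; definability.
  (* The stronger condition is in place 0; [s] skips the old condition in place 1. *)
  pose s n := if n is m.+1 then m.+2 else 0.
  by apply: dfn_imp; [exact: (dfn_ren s IHg)|exact: (dfn_ren s IHh)].
(* Here [s] exchanges the quantified set and the condition. *)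
- apply: dfn_all; pose s n := if n is m.+1 then if m is 0 then 0 else m.+1 else 1.
  apply: dfn_ext (dfn_ren s IHg) => e /=.
  suff -> : (fun n => e (s n.+1)) = scons (e 0) (fun n => e n.+2) by [].
  by apply/funext; case.
Qed.

Lemma def_force_scons f v : def2 (fun x p => force f p (scons x v)).
Proof.
pose t n (e : nat -> M) := if n is m.+1 then scons (e 0) v m else e 1.
apply: dfn_ext (dfn_subst (t := t) _ (def_force f)) => // -[|[|n]] /=.
- by left; exists 1.
- by left; exists 0.
- by right; exists (v n).
Qed.

Lemma def_force_not f v : def2 (fun x p => force_not f p (scons x v)).
Proof.
have dc := def_cond; have df := def_force_scons f v; have d := v 0.
by cbv delta [force_not subset_in]; definability.
Qed.

(** For a formula meant to define a class function: the condition forces some value at [x] or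
    refutes every value. *)
Definition decides_value f v x q :=
  (exists y, force f q (scons (opair x y) v)) \/
  forall y, force_not f q (scons (opair x y) v).

(** Distributivity handles all elements of [a] by one condition, which is what Class Replacement
    will rest on. *)
Lemma decides_values_dense f v a p : cond p ->
  exists q, [/\ cond q, sub p q & forall x, E x a -> decides_value f v x q].
Proof.
move=> cp; have d := p.
apply: (distributivity (hZF := hZF) hAC (D := decides_value f v) def_cond) => //.
- have := def_force_not f v; have := def_force_scons f v.
  rewrite /decides_value.
  (* Opaque names make the tactic treat forcing statements as atoms. *)
  set A := (fun x p => force f p (scons x v)).
  set B := (fun x p => force_not f p (scons x v)) => dA dB.
  change (def2 (fun x q =>
    (exists y, A (opair x y) q) \/ forall y, B (opair x y) q)).
  by clearbody A B; definability.
- exact: cond_chain.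
- move=> x q _ cq.
  case: (pselect (forall y, force_not f q (scons (opair x y) v))) => [H|].
    by exists q; split=> //; right.
  move=> /existsNP[y /existsNP[r /not_implyP[cr /not_implyP[qr /contrapT H]]]].
  by exists r; split=> //; left; exists y.
- move=> x q q' _ _ _ qq' [[y H]|H]; [left; exists y|right=> y].
    exact: force_mono H.
  exact: force_not_mono (H y).
Qed.

(** Otherwise forcing of [f] by some extension of [p] would define [F]: an extension forcing [f] at
    a point outside [F], or refuting it at a point of [F], is a separation. *)
Lemma separating_dense F f v p : ~ def1 F -> cond p ->
  exists q, [/\ cond q, sub p q & exists x,
    (force f q (scons x v) /\ ~ F x) \/ (force_not f q (scons x v) /\ F x)].
Proof.
move=> nF cp; apply: contrapT => H; apply: nF.
have df := def_force_scons f v; have dc := def_cond; have d := p.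
apply: (@dfn_ext _ _ _ _ (fun e =>
    exists q, [/\ cond q, sub p q & force f q (scons (e 0) v)])).
  move=> e; split=> [[q [cq pq fq]]|Fe].
    apply: contrapT => nF; apply: H; exists q; split=> //.
    by exists (e 0); left.
  have [q [cq pq [fq|fq]]] := force_or_not f (scons (e 0) v) cp.
    by exists q.
  by case: H; exists q; split=> //; exists (e 0); right.
by cbv delta [subset_in]; definability.
Qed.

(** The Rasiowa-Sikorski argument; having countably many requirements allows a chain indexed by
    [nat]. *)
Lemma generic_chain (D : nat -> M -> Prop) :
  (forall n p, cond p -> exists q, [/\ cond q, sub p q & D n q]) ->
  exists P : nat -> M, forall n,
    [/\ cond (P n), sub (P n) (P n.+1) & D n (P n.+1)].
Proof.
move=> HD; have [p0 cp0] := cond_empty.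
(* Off the conditions the value of [g] is arbitrary. *)
have /choice[g Hg] : forall np : nat * M, exists q, cond np.2 ->
    [/\ cond q, sub np.2 q & D np.1 q].
  move=> [n p] /=; case: (pselect (cond p)) => [/(HD n)[q Hq]|]; last by exists p.
  by exists q.
pose P := fix P n := if n is m.+1 then g (m, P m) else p0.
have cP n : cond (P n) by elim: n => //= n /(Hg (n, _))[].
by exists P => n; have [] := Hg (n, P n) (cP n).
Qed.

Lemma mapsP (A : set M) x y : maps E A x y <-> A (opair x y).
Proof.
by split=> [[z /(is_pairP hZF) ->]|Axy]; last exists (opair x y); rewrite ?is_pairP.
Qed.

(** * The generic class, the truth lemma and the realization it generates *)

Section Generic.
Variables (d : M) (P : nat -> M).
Hypotheses (cP : forall n, cond (P n)) (sP : forall n, sub (P n) (P n.+1)).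

Let G : set M := [set x | exists n, E x (P n)].
Let W : 'I_1 -> set M := fun=> G.

(** The genericity asked of the chain: the first three items serve the truth lemma, with
    [decided_all] supplying witnesses; [decided_values] serves Class Replacement, and the last two
    make [G] a bijection. *)
Hypotheses
  (decided : forall f s, exists n,
    force f (P n) (nth d s) \/ force_not f (P n) (nth d s))
  (decided_all : forall f s, exists n, force (FAll f) (P n) (nth d s) \/
    exists x, force_not f (P n) (scons x (nth d s)))
  (decided_cls : forall x, exists n, E x (P n) \/
    forall q, cond q -> sub (P n) q -> ~ E x q)
  (decided_values : forall f s a, exists n, forall x, E x a ->
    decides_value f (nth d s) x (P n))
  (domP : forall x, exists n b, E (opair x b) (P n))
  (ranP : forall b, ord b -> exists n x, E (opair x b) (P n)).

Lemma chain_mono m n : m <= n -> sub (P m) (P n).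
Proof.
elim: n => [|n IHn]; first by rewrite leqn0 => /eqP ->.
rewrite leq_eqVlt => /predU1P[-> //|]; rewrite ltnS => /IHn H.
by move=> x /H/sP.
Qed.

Lemma chain_consistent f m n e : force f (P m) e -> force_not f (P n) e -> False.
Proof.
move=> fm fn; apply: (fn (P (maxn m n))) => //.
  exact: chain_mono (leq_maxr _ _).
exact: force_mono (chain_mono (leq_maxl m n)) fm.
Qed.

(** Induction on [f]. Where truth has to yield forcing, the chain decides the relevant statement,
    and a wrong decision would contradict consistency of the chain. *)
Lemma truth f s : sat E W (nth d s) f <-> exists n, force f (P n) (nth d s).
Proof.
elim: f s => [i j|i j|i c||g IHg h IHh|g IHg] s /=.
- by split=> [|[]//]; exists 0.
- by split=> [|[]//]; exists 0.
- split=> [[n Hn]|[n Hn]].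
    by exists n => q cq /(_ _ Hn) xq; exists q; split.
  have [m [Hm|Hm]] := decided_cls (nth d s i); first by exists m.
  have [|r [cr Pr xr]] := Hn (P (maxn m n)) (cP _).
    exact: chain_mono (leq_maxr _ _).
  by case: (Hm r cr _ xr); exact: sub_trans (chain_mono (leq_maxl m n)) Pr.
- by split=> // -[].
- split=> [Hgh|[n Hn] /IHg[m Hm]].
    have [n [Hn|Hn]] := decided (FImp g h) s; first by exists n.
    (* If [g] is forced, then [h] is true and hence forced; if [g] is refuted, the implication is
       forced vacuously. *)
    have [m [Hm|Hm]] := decided g s.
      have /Hgh/IHh[k Hk] : sat E W (nth d s) g by apply/IHg; exists m.
      exists k => q cq kq _; exact: force_mono kq Hk.
    by exists m => q cq mq /(Hm q cq mq).
  apply/IHh; exists (maxn m n); apply: Hn => //.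
    exact: chain_mono (leq_maxr _ _).
  exact: force_mono (chain_mono (leq_maxl m n)) Hm.
- split=> [Hg|[n Hn] x]; last first.
    by rewrite scons_nth; apply/IHg; exists n; rewrite -scons_nth.
  have [n [Hn|[x Hx]]] := decided_all g s; first by exists n.
  have := Hg x; rewrite scons_nth => /IHg[m Hm].
  by rewrite scons_nth in Hx; case: (chain_consistent Hm Hx).
Qed.

Lemma GBC_generic : GBC_realization E [set A | dfn1 E W A].
Proof.
have inG m n z z' : E z (P m) -> E z' (P n) ->
    E z (P (maxn m n)) /\ E z' (P (maxn m n)).
  by move=> zm z'n; split; [apply: chain_mono zm; exact: leq_maxl
    |apply: chain_mono z'n; exact: leq_maxr].
split.
  apply: GB_dfn1 => // A /(dfn1_seqP d)[f [s Hf]] [_ funA] a.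
  have Hfn z : A z <-> exists n, force f (P n) (scons z (nth d s)).
    by rewrite Hf scons_nth truth.
  (* A single [P n] decides all values on [a], so the image is given by forcing at [P n], which is
     definable over [M], and Replacement in [M] makes it a set. *)
  have [n Hn] := decided_values f s a.
  have [||b Hb] := repl_ex hZF
    (P := fun x y => force f (P n) (scons (opair x y) (nth d s))) _ (a := a).
  - have := def_force_scons f (nth d s).
    set B := (fun x p => force f p (scons x (nth d s))) => dB.
    change (def2 (fun x y => B (opair x y) (P n))).
    by clearbody B; definability.
  - move=> x y y' _ Hy Hy'; apply: (funA x); apply/mapsP; apply/Hfn; by exists n.
  exists b => y; rewrite Hb; split=> -[x xa H]; exists x => //.
    by apply/mapsP/Hfn; exists n.
  have [[y' Hy']|Hno] := Hn x xa.
    suff -> : y = y' by [].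
    by apply: (funA x) => //; apply/mapsP/Hfn; exists n.
  by have /mapsP/Hfn[m Hm] := H; case: (chain_consistent Hm (Hno y)).
(* The generic class itself witnesses Global Choice. *)
exists G.
  exact: (@dfn_cls _ E _ W ord0 _ (tdf_var E W 0 d)).
split=> [|x|x y /mapsP[n xn]|x x' y /mapsP[n xn] /mapsP[m xm]
  |y /(is_ordinalP hZF) oy].
- split=> [z [n zn]|x y y' /mapsP[n xn] /mapsP[m xm]].
    have [H _ _] := cP n; have [x [b [_ ->]]] := H z zn.
    by exists x, b; apply/is_pairP.
  have [Hn Hm] := inG _ _ _ _ xn xm; have [_ H _] := cP (maxn n m); exact: H Hn Hm.
- by have [n [b Hb]] := domP x; exists b; apply/mapsP; exists n.
- have [H _ _] := cP n; have [x' [b [ob /opairI[_ ->]]]] := H _ xn.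
  exact/(is_ordinalP hZF).
- have [Hn Hm] := inG _ _ _ _ xn xm; have [_ _ H] := cP (maxn n m); exact: H Hn Hm.
- by have [n [x Hx]] := ranP oy; exists x; apply/mapsP; exists n.
Qed.

End Generic.

(** * A realization omitting an undefinable class *)

Lemma generic_realization_omitting (F : set M) :
  countable [set: M] -> ~ def1 F ->
  exists2 Y, GBC_realization E Y & ~ Y F.
Proof.
move=> /countable_injP[iM iMinj] nF; have [d _] := zf_infinity hZF.
have iM_inj : injective iM by move=> x y; apply: iMinj; rewrite inE.
(* Kinds 0 to 5 are the genericity hypotheses in their order; every further kind separates [F] from
   the class that [f] and [s] define. Arguments foreign to a kind get default values. *)
pose Req (j : nat) (f : formula 1) (s : seq M) (a q : M) : Prop :=
  match j with
  | 0 => force f q (nth d s) \/ force_not f q (nth d s)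
  | 1 => force (FAll f) q (nth d s) \/ exists x, force_not f q (scons x (nth d s))
  | 2 => E a q \/ forall r, cond r -> sub q r -> ~ E a r
  | 3 => forall x, E x a -> decides_value f (nth d s) x q
  | 4 => exists b, E (opair a b) q
  | 5 => ord a -> exists x, E (opair x a) q
  | _ => exists x, (force f q (scons x (nth d s)) /\ ~ F x) \/
      (force_not f q (scons x (nth d s)) /\ F x)
  end.
have Req_dense j f s a p : cond p ->
    exists q, [/\ cond q, sub p q & Req j f s a q].
  move=> cp; case: j => [|[|[|[|[|[|j]]]]]] /=.
  - exact: force_or_not.
  - case: (pselect (exists q x,
        [/\ cond q, sub p q & force_not f q (scons x (nth d s))])).
      by move=> [q [x [cq pq H]]]; exists q; split=> //; right; exists x.
    move=> H; exists p; split=> //; left=> x; apply: force_stable => // q cq pq fx.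
    by apply: H; exists q, x.
  - case: (pselect (exists r, [/\ cond r, sub p r & E a r])) => [[r [cr pr ar]]|H].
      by exists r; split=> //; left.
    by exists p; split=> //; right=> r cr pr ar; apply: H; exists r.
  - exact: decides_values_dense.
  - exact: cond_dom.
  - case: (pselect (ord a)) => [/(cond_ran cp)[q [cq pq Hq]]|na]; last first.
      by exists p; split.
    by exists q.
  - exact: separating_dense.
pose code (j : nat) (f : formula 1) (s : seq M) (a : M) : nat :=
  pickle (j, formula_tree f, [seq iM x | x <- s], iM a).
have code_inj j f s a j' f' s' a' : code j f s a = code j' f' s' a' ->
    [/\ j = j', f = f', s = s' & a = a'].
  move=> /(pcan_inj pickleK)[-> /formula_tree_inj ->].
  by move=> /(inj_map iM_inj) -> /iM_inj ->.
(* Step [n] meets the requirement with code [n]; numbers that are no code impose nothing. *)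
have [|P HP] := @generic_chain (fun n q =>
    forall j f s a, code j f s a = n -> Req j f s a q).
  move=> n p cp.
  case: (pselect (exists j f s a, code j f s a = n)) => [[j [f [s [a jn]]]]|H].
    have [q [cq pq Hq]] := Req_dense j f s a p cp; exists q; split=> //.
    by move=> j' f' s' a'; rewrite -jn => /code_inj[-> -> -> ->].
  by exists p; split=> // j f s a jn; case: H; exists j, f, s, a.
have met j f s a : exists n, Req j f s a (P n).
  by exists (code j f s a).+1; have [_ _] := HP (code j f s a); exact.
have f0 := FFalse 1.
have cP n : cond (P n) by case: (HP n).
have sP n : sub (P n) (P n.+1) by case: (HP n).
have decided f s := met 0 f s d.
have decided_all f s := met 1 f s d.
have decided_cls a := met 2 f0 [::] a.
have decided_values f s a := met 3 f s a.
have domP x := met 4 f0 [::] x.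
have ranP b : ord b -> exists n x, E (opair x b) (P n).
  by move=> ob; have [n Hn] := met 5 f0 [::] b; exists n; exact: Hn.
exists [set A | dfn1 E (fun _ : 'I_1 => [set x | exists n, E x (P n)]) A].
  by apply: (@GBC_generic d P).
move=> /= /(dfn1_seqP d)[f [s Hf]].
have tr x := @truth d P cP sP decided decided_all decided_cls f (x :: s).
(* At the separating [x], truth and forcing would disagree if [f] defined [F] from the generic
   class. *)
have [n [x [[fx nFx]|[fx Fx]]]] := met 6 f s d.
  apply: nFx; apply/Hf; rewrite scons_nth; apply/tr.
  by exists n; rewrite -scons_nth.
have := (Hf x).1 Fx; rewrite scons_nth => /tr[m]; rewrite -scons_nth => Hm.
exact: (chain_consistent cP sP Hm fx).
Qed.

(** * Definable well-orders and definable bijections with the ordinals *)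

Lemma GBC_definable R : def2 R -> global_well_order E R ->
  GBC_realization E [set A | def1 A].
Proof.
move=> dR woR; have [d _] := zf_infinity hZF.
have [F [dF Ffun Ford Finj Fsurj]] := enumeration_of_wellorder hZF dR woR.
split.
  apply: GB_dfn1 => // A dA [_ funA] a.
  have [||b Hb] := repl_ex hZF (P := fun x y => A (opair x y)) _ (a := a).
  - by definability.
  - by move=> x y y' _ xy xy'; apply: (funA x); apply/mapsP.
  by exists b => y; rewrite Hb; split=> -[x xa /mapsP H]; exists x.
(* The enumeration runs from ordinals to sets; [B] is its inverse as a class of pairs. *)
pose B : set M := [set z | exists x b, F b x /\ z = opair x b].
have BE x b : maps E B x b <-> F b x.
  rewrite mapsP; split=> [[y [c [Fy /opairI[-> ->]]]]//|Fx].
  by exists x, b.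
exists B.
  change (def1 (fun z => exists x b, F b x /\ z = opair x b)).
  by definability.
split=> [|x|x b /BE Fx|x x' b /BE Fx /BE Fx'|b].
- split=> [z [x [b [_ ->]]]|x b c /BE Fb /BE Fc]; last exact: Finj Fb Fc.
  by exists x, b; apply/is_pairP.
- by have [b Fb] := Fsurj x; exists b; apply/BE.
- by apply/(is_ordinalP hZF)/Ford; exists x.
- exact: Ffun Fx Fx'.
- by move=> /(is_ordinalP hZF)/Ford[x Fx]; exists x; apply/BE.
Qed.

Lemma wellorder_of_bijection (F : set M) : def1 F -> bijection_V_Ord E F ->
  exists R, def2 R /\ global_well_order E R.
Proof.
move=> dF [[_ Ffun] Ftot Ford Finj _]; have [d _] := zf_infinity hZF.
have Fo x b : F (opair x b) -> ord b by move=> /mapsP/Ford/(is_ordinalP hZF).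
have Ff x b c : F (opair x b) -> F (opair x c) -> b = c.
  by move=> /mapsP Fb /mapsP Fc; exact: Ffun Fb Fc.
have Fi x y b : F (opair x b) -> F (opair y b) -> x = y.
  by move=> /mapsP Fb /mapsP Fc; exact: Finj Fb Fc.
have Ft x : exists b, F (opair x b).
  by have [b /mapsP] := Ftot x; exists b.
(* Sets are compared by their ordinals under [F], so least elements of definable classes come from
   [ord_least]. *)
pose R x y := exists b c, [/\ F (opair x b), F (opair y c) & E b c].
exists R; split; first by cbv delta [R]; definability.
split=> [x [b [c [xb xc]]]|x y z|x y|A /definable_classP dA [x Ax]].
- by rewrite (Ff _ _ _ xb xc); exact: no_cycle1.
- move=> [b [c [xb yc bc]]] [c' [e [yc' ze ce]]].
  exists b, e; split=> //; rewrite (Ff _ _ _ yc' yc) in ce.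
  exact: ord_trans (Fo _ _ ze) ce bc.
- have [b xb] := Ft x; have [c yc] := Ft y.
  case: (ord_tri hZF (Fo _ _ xb) (Fo _ _ yc)) => [bc|[bc|cb]].
  + by left; exists b, c.
  + by right; left; rewrite bc in xb; exact: Fi xb yc.
  + by right; right; exists c, b.
- have [b xb] := Ft x.
  have [||m [om [y [Ay ym]] Hm]] := @ord_least _ _ hZF
    (fun b => exists y, A y /\ F (opair y b)) b _ (Fo _ _ xb).
  + by definability.
  + by exists x.
  exists y => // z Az; have [c zc] := Ft z.
  case: (ord_tri hZF om (Fo _ _ zc)) => [mc|[mc|/Hm[]]].
  + by right; exists m, c.
  + by left; rewrite mc in ym; exact: Fi ym zc.
  + by exists z.
Qed.

End Forcing.

Theorem theorem1 (M : Type) (E : M -> M -> Prop)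
    (hcount : countable [set: M]) (hZFC : ZFC E) :
  (exists X : set (set M), minimum_GBC_realization E X) <->
  (exists R : M -> M -> Prop, definable_relation E R /\ global_well_order E R).
Proof.
have [hZF hAC] := hZFC; split.
- move=> [X [[gbX [F XF bijF]] minX]].
  have dF : dfn1 E (fun _ : 'I_0 => set0) F.
    apply: contrapT => nF.
    have [Y gbcY nYF] := generic_realization_omitting hZF hAC hcount nF.
    exact: nYF (minX Y gbcY F XF).
  have [R [dR woR]] := wellorder_of_bijection hZF dF bijF.
  by exists R; split=> //; apply/definable_relationP.
- move=> [R [/definable_relationP dR woR]].
  exists [set A | dfn1 E (fun _ : 'I_0 => set0) A]; split.
    exact: GBC_definable woR.
  move=> Y [gbY _] A /= /definable_classP[f [v ->]].
  (* Comprehension is applied with no class parameters, so the condition on them is vacuous. *)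
  by apply: (gb_elementary_comprehension gbY) => -[].
Qed.
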